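(* Let $G$ be the group of upper triangular $4\times 4$ matrices with integer entries and all diagonal entries equal to $1$. The map $$(H,\chi)\longmapsto \mathrm{ind}_H^G(\chi)$$ induces a one-to-one correspondence between the following two spaces: 1. the (disjoint) union $X_{1,1}\sqcup X_{2,0}\sqcup X_{2,1}\sqcup X_{1,2}\sqcup X_{2,2}\sqcup X_{3,2}$ of the total spaces of the bundles $X_{r_1,r_2}\to \Xi_{r_1,r_2}$ for $(r_1,r_2)\in\{(1,1),(2,0),(2,1),(1,2),(2,2),(3,2)\}$; 2. the coarse moduli space (the set of isomorphism classes) of irreducible complex representations of $G$ which have finite weight.
   Context: All representations are over $\mathbb{C}$. A character of a group $H$ is a homomorphism $\chi:H\to\mathbb{C}^*$. For a subgroup $H\subset G$ and a character $\chi$ of $H$, $\mathrm{ind}_H^G(\chi)$ denotes the finitely induced representation (functions $f:G\to\mathbb{C}$ that transform on one side under $H$ by $\chi$ and are supported on finitely many cosets of $H$; equivalently $\mathbb{C}[G]\otimes_{\mathbb{C}[H]}\mathbb{C}_\chi$). A representation $\pi$ of $G$ has finite weight if there are a subgroup $H\subset G$ and a character $\chi$ of $H$ such that $\mathrm{Hom}_H(\chi,\pi|_H)$ is non-zero and finite-dimensional. An irreducible weight pair is a pair $(H,\chi)$ with $H\subset G$ a subgroup and $\chi$ a character of $H$ such that $\mathrm{ind}_H^G(\chi)$ is irreducible. Let $Y$ be the set of all irreducible weight pairs, and let $\Sigma$ be the set of all subgroups $H$ occurring in pairs of $Y$. Two irreducible weight pairs are equivalent, $(H_1,\chi_1)\sim(H_2,\chi_2)$,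 if $\mathrm{ind}_{H_1}^G(\chi_1)\simeq\mathrm{ind}_{H_2}^G(\chi_2)$. For a subgroup $H\subset G$, $H^*$ denotes the smallest subgroup of $G$ containing $H$ such that $g\in G$ and $g^i\in H^*$ for some positive integer $i$ imply $g\in H^*$. For $g\in G$ write $H^g=gHg^{-1}$ and, for a character $\chi$ of $H$, let $\chi^g$ be the character of $H^g$ given by $\chi^g(x)=\chi(g^{-1}xg)$. $X$ is the quotient of $Y$ by the equivalence relation generated by: (a) $(H,\chi_1)\sim_f(H,\chi_2)$ whenever these two pairs with the same subgroup are equivalent; (b) $(H_1,\chi_1)\sim_*(H_2,\chi_2)$ whenever the pairs are equivalent and $H_1^*=H_2^*$; (c) $(H,\chi)$ is identified with $(H^g,\chi^g)$ for $g\in G$. $\Xi$ is the quotient of $\Sigma$ by the relation: $H_1$ and $H_2$ are identified if there is $g\in G$ with $(H_1^* )^g=H_2^*$. There is a natural surjection $X\to\Xi$ sending the class of $(H,\chi)$ to the class of $H$. Put $\gamma_1(G)=[G,G]$ and $\gamma_2(G)=[G,\gamma_1(G)]$ (which equals the center $Z(G)$). For a subgroup $H\subset G$ let $\mathrm{rk}_1(H)=\mathrm{rk}\big(H/(H\cap[G,G])\big)$ and $\mathrm{rk}_2(H)=\mathrm{rk}\big((H\cap\gamma_1(G))/(H\cap\gamma_2(G))\big)$, where $\mathrm{rk}$ is the rank of a finitely generated abelian group. These ranks depend only on the class of $H$ in $\Xi$. $\Xi_{r_1,r_2}$ denotes the set of classes in $\Xi$ of subgroups $H\in\Sigma$ with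 $\mathrm{rk}_1(H)=r_1$, $\mathrm{rk}_2(H)=r_2$, and $X_{r_1,r_2}\to\Xi_{r_1,r_2}$ is the restriction of $X\to\Xi$ to $\Xi_{r_1,r_2}$. *)

(* Defs.v *)
From HB Require Import structures.
From Stdlib Require Export Relation_Operators.
From mathcomp Require Export all_boot all_order all_algebra generic_quotient.
From mathcomp Require Export boolp classical_sets functions reals complex.

Set Implicit Arguments.
Unset Strict Implicit.
Unset Printing Implicit Defensive.

Import GRing.Theory.
Local Open Scope ring_scope.
Local Open Scope quotient_scope.

Section Subgroups.
Variable G : groupType.
Local Open Scope group_scope.

(* The library's [groupClosed G] lives in too large a universe to be the
   carrier of a quotient; the instances below make its theory available. *)
Record subgroup := Subgroup {
  sg_pred : G -> bool;
  sg_closed : group_closed (sg_pred : {pred G}) }.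

Definition sg_mem (H : subgroup) : {pred G} := sg_pred H.
Coercion sg_mem : subgroup >-> pred_sort.

Lemma sg_mem_closed (H : subgroup) : group_closed (sg_mem H).
Proof. exact: sg_closed. Qed.

Lemma sg_mem1 (H : subgroup) : 1 \in H.
Proof. exact: (sg_mem_closed H).1. Qed.

HB.instance Definition _ (H : subgroup) :=
  isMulClosed.Build G (sg_mem H) (group_closedM (sg_mem_closed H)).
HB.instance Definition _ (H : subgroup) :=
  isInvClosed.Build G (sg_mem H) (group_closedV (sg_mem_closed H)).
HB.instance Definition _ (H : subgroup) :=
  isMul1Closed.Build G (sg_mem H) (sg_mem1 H).

Definition subg_of (H : subgroup) := {x : G | x \in H}.

HB.instance Definition _ (H : subgroup) := SubType.on (subg_of H).
HB.instance Definition _ (H : subgroup) := Choice.on (subg_of H).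
HB.instance Definition _ (H : subgroup) :=
  SubChoice_isSubGroup.Build G _ (subg_of H) (sg_mem_closed H).

(* In MathComp [x ^ g] is [g^-1 * x * g], so this is the subset [g A g^-1]. *)
Definition conj_set (g : G) (A : {pred G}) : {pred G} :=
  [pred x | x ^ g \in A].

Lemma conj_setE g A x : (x \in conj_set g A) = (x ^ g \in A).
Proof. by []. Qed.

Lemma smallest_subgroup_closed (P : subgroup -> Prop) :
  group_closed [pred x | `[< forall K : subgroup, P K -> x \in K >]].
Proof.
split=> [|x y]; first by apply/asboolP => K _; exact: gpred1.
move=> /asboolP Hx /asboolP Hy; apply/asboolP => K PK.
by apply: gpredF; [exact: Hx|exact: Hy].
Qed.

(* The intersection of all subgroups satisfying [P]. *)
Definition smallest_subgroup (P : subgroup -> Prop) : subgroup :=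
  Subgroup (smallest_subgroup_closed P).

Definition root_closed (A : {pred G}) : Prop :=
  forall (g : G) (i : nat), (0 < i)%N -> g ^+ i \in A -> g \in A.

(* The subgroup [H^*]. *)
Definition isolator (H : {pred G}) : subgroup :=
  smallest_subgroup (fun K => {subset H <= K} /\ root_closed K).

Definition commutator (A B : {pred G}) : subgroup :=
  smallest_subgroup (fun K => {in A & B, forall x y, [~ x, y] \in K}).

Definition gamma1 : subgroup := commutator predT predT.
Definition gamma2 : subgroup := commutator predT gamma1.

Definition expgz (x : G) (m : int) : G :=
  match m with Posz n => x ^+ n | Negz n => x ^- n.+1 end.

(* For subgroups [B <= A] with [A / B] abelian: the cosets of [a 0, ...,
   a (n - 1)] form a Z-linearly independent family of [A / B]. *)
Definition indep_mod (A B : {pred G}) (n : nat) (a : 'I_n -> G) : Prop :=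
  (forall i, a i \in A) /\
  (forall m : 'I_n -> int,
     \prod_(i < n) expgz (a i) (m i) \in B -> forall i, m i = Posz 0).

(* The rank of the abelian group [A / B] is [r]. *)
Definition has_rank (A B : {pred G}) (r : nat) : Prop :=
  (exists a : 'I_r -> G, indep_mod A B a) /\
  (forall n (a : 'I_n -> G), indep_mod A B a -> (n <= r)%N).

Definition has_rk1 (H : {pred G}) (r : nat) : Prop :=
  has_rank H [predI H & gamma1] r.

Definition has_rk2 (H : {pred G}) (r : nat) : Prop :=
  has_rank [predI H & gamma1] [predI H & gamma2] r.

End Subgroups.

Section Representations.
Variables (G : groupType) (K : fieldType).

Record representation := Representation {
  rep_space :> lmodType K;
  rep_act : G -> rep_space -> rep_space;
  rep_linear : forall g, linear (rep_act g);
  rep_act1 : forall v, rep_act 1%g v = v;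
  rep_actM : forall g h v, rep_act (g * h)%g v = rep_act g (rep_act h v) }.

Definition intertwiners (V W : representation) : set (V -> W) :=
  [set phi | linear phi /\
     forall g v, phi (rep_act g v) = rep_act g (phi v)]%classic.

Definition rep_iso (V W : representation) : Prop :=
  exists2 phi : V -> W, intertwiners phi & bijective phi.

Definition irreducible (V : representation) : Prop :=
  (exists v : V, v != 0) /\
  forall W : {pred V}, submod_closed W ->
    (forall g, {in W, forall v, rep_act g v \in W}) ->
    W =i pred1 0 \/ W =i predT.

(* [E] is the set underlying a linear subspace of [L]. *)
Definition finite_dim (L : lmodType K) (E : set L) : Prop :=
  exists n (b : 'I_n -> L), (forall i, E (b i)) /\
    forall v, E v -> exists c : 'I_n -> K, v = \sum_(i < n) c i *: b i.

End Representations.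

Section Induction.
Variables (G : groupType) (K : fieldType).

Record character (H : subgroup G) := Character {
  char_val :> subg_of H -> K;
  char_neq0 : forall x, char_val x != 0;
  char_mul : forall x y, char_val (x * y)%g = char_val x * char_val y }.

Variable H : subgroup G.

Lemma character1 (chi : character H) : chi 1%g = 1.
Proof.
apply: (mulfI (char_neq0 chi 1%g)).
by rewrite -char_mul mulr1 mulg1.
Qed.

Section CharacterRep.
Variable chi : character H.

Lemma char_act_linear x : linear (fun v : K^o => chi x *: v : K^o).
Proof. by move=> a u v; rewrite scalerDr !scalerA mulrC. Qed.

Lemma char_act1 (v : K^o) : chi 1%g *: v = v.
Proof. by rewrite character1 scale1r. Qed.

Lemma char_actM x y (v : K^o) : chi (x * y)%g *: v = chi x *: (chi y *: v).
Proof. by rewrite scalerA char_mul. Qed.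

Definition char_rep : representation (subg_of H) K :=
  Representation char_act_linear char_act1 char_actM.

End CharacterRep.

Section Restriction.
Variable V : representation G K.

Lemma res_act1 (v : V) : rep_act (val (1%g : subg_of H)) v = v.
Proof. by rewrite val1 rep_act1. Qed.

Lemma res_actM (x y : subg_of H) (v : V) :
  rep_act (val (x * y)%g) v = rep_act (val x) (rep_act (val y) v).
Proof. by rewrite valM rep_actM. Qed.

Definition res_rep : representation (subg_of H) K :=
  @Representation _ _ V (fun x => rep_act (val x))
    (fun x => rep_linear (val x)) res_act1 res_actM.

End Restriction.

Section FiniteInduction.
Variable chi : character H.

(* Functions [f] with [f (h x) = chi h * f x], supported on finitely many
   cosets [H g], on which [G] acts by right translations.  The function equal
   to [chi] on [H] and to [0] elsewhere is a [chi]-eigenvector for [H]. *)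
Definition ind_pred : {pred G -> K^o} :=
  [pred f : G -> K^o | `[<
    (forall (h : subg_of H) x, f (val h * x)%g = chi h * f x) /\
    exists s : seq G, forall x, f x != 0 ->
      exists2 g, g \in s & (x / g)%g \in H >]].

Lemma ind_pred_submod : submod_closed ind_pred.
Proof.
split.
  apply/asboolP; split; first by move=> h x; rewrite mulr0.
  by exists [::] => x /eqP[].
move=> a u v /asboolP[u1 [s us]] /asboolP[v1 [t vt]]; apply/asboolP.
have E x : (a *: u + v) x = a * u x + v x by [].
split=> [h x|]; first by rewrite !E u1 v1 mulrDr mulrCA.
exists (s ++ t) => x; rewrite E.
have [u0|/us[g gs xg] _] := eqVneq (u x) 0; last first.
  by exists g => //; rewrite mem_cat gs.
rewrite u0 mulr0 add0r => /vt[g gt xg].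
by exists g => //; rewrite mem_cat gt orbT.
Qed.

HB.instance Definition _ :=
  GRing.isSubmodClosed.Build K (G -> K^o) ind_pred ind_pred_submod.

Record ind_space := IndSpace {
  ind_fun :> G -> K^o;
  _ : ind_fun \in ind_pred }.

HB.instance Definition _ := [isSub for ind_fun].
HB.instance Definition _ := [Choice of ind_space by <:].
HB.instance Definition _ := [SubChoice_isSubLmodule of ind_space by <:].

Lemma ind_act_subproof (g : G) (f : ind_space) :
  (fun x => f (x * g)%g) \in ind_pred.
Proof.
case: f => f /= /asboolP[f1 [s fs]]; apply/asboolP; split=> [h x|].
  by rewrite -mulgA f1.
exists [seq (y / g)%g | y <- s] => x /fs[y ys xy].
by exists (y / g)%g; [exact: map_f|rewrite invgF mulgA].
Qed.

Definition ind_act (g : G) (f : ind_space) : ind_space :=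
  IndSpace (ind_act_subproof g f).

Lemma ind_act_linear g : linear (ind_act g).
Proof. by move=> a u v; apply/val_inj. Qed.

Lemma ind_act1 f : ind_act 1%g f = f.
Proof. by apply/val_inj/funext => x /=; rewrite mulg1. Qed.

Lemma ind_actM g h f : ind_act (g * h)%g f = ind_act g (ind_act h f).
Proof. by apply/val_inj/funext => x /=; rewrite mulgA. Qed.

Definition ind_rep : representation G K :=
  Representation ind_act_linear ind_act1 ind_actM.

End FiniteInduction.
End Induction.

Definition finite_weight (G : groupType) (K : fieldType)
    (V : representation G K) : Prop :=
  exists (H : subgroup G) (chi : character K H),
    let homs := @intertwiners _ _ (char_rep chi) (res_rep H V) in
    (exists2 phi, homs phi & exists z, phi z != 0) /\ finite_dim homs.

Section ModuliSpace.
Variables (G : groupType) (K : fieldType).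

(* [representation G K] lives in too large a universe for [set] and for
   [choiceType], hence isomorphism classes are bare predicates on it. *)
Definition iso_class (V : representation G K) : representation G K -> Prop :=
  fun W => rep_iso V W.

Definition moduli (c : representation G K -> Prop) : Prop :=
  exists V, [/\ c = iso_class V, irreducible V & finite_weight V].

(* [set_bij], without its constraint on the universe of [U]. *)
Definition bij_between (T U : Type) (A : T -> Prop) (B : U -> Prop)
    (f : T -> U) : Prop :=
  [/\ forall x, A x -> B (f x),
      forall x1 x2, A x1 -> A x2 -> f x1 = f x2 -> x1 = x2
    & forall u, B u -> exists2 x, A x & f x = u].

End ModuliSpace.

Section WeightPairs.
Variables (G : groupType) (K : fieldType).

(* The set Y of irreducible weight pairs. *)
Record irr_pair := IrrPair {
  ip_sub : subgroup G;
  ip_char : character K ip_sub;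
  ip_irr : irreducible (ind_rep ip_char) }.

Definition ip_ind (y : irr_pair) : representation G K := ind_rep (ip_char y).

(* The set Sigma. *)
Record weight_subgroup := WeightSubgroup {
  ws_sub :> subgroup G;
  ws_irr : exists chi : character K ws_sub, irreducible (ind_rep chi) }.

Definition ip_ws (y : irr_pair) : weight_subgroup :=
  WeightSubgroup (ex_intro _ (ip_char y) (ip_irr y)).

(* [y2] is the pair [(H^g, chi^g)], where [y1] is the pair [(H, chi)]. *)
Definition conj_pair (g : G) (y1 y2 : irr_pair) : Prop :=
  ip_sub y2 =i conj_set g (ip_sub y1) /\
  forall (x : subg_of (ip_sub y2)) (z : subg_of (ip_sub y1)),
    val z = (val x ^ g)%g -> ip_char y2 x = ip_char y1 z.

Inductive X_step (y1 y2 : irr_pair) : Prop :=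
| X_step_f of ip_sub y1 =i ip_sub y2 & rep_iso (ip_ind y1) (ip_ind y2)
| X_step_star of isolator (ip_sub y1) =i isolator (ip_sub y2)
    & rep_iso (ip_ind y1) (ip_ind y2)
| X_step_conj g of conj_pair g y1 y2.

Definition X_rel (y1 y2 : irr_pair) : bool :=
  `[< clos_refl_sym_trans irr_pair X_step y1 y2 >].

Definition Xi_rel (H1 H2 : weight_subgroup) : bool :=
  `[< exists g : G, conj_set g (isolator H1) =i isolator H2 >].

HB.instance Definition _ := gen_eqMixin irr_pair.
HB.instance Definition _ := gen_choiceMixin irr_pair.
HB.instance Definition _ := gen_eqMixin weight_subgroup.
HB.instance Definition _ := gen_choiceMixin weight_subgroup.

Lemma X_rel_refl : reflexive X_rel.
Proof. by move=> y; apply/asboolP/rst_refl. Qed.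

Lemma X_rel_sym : symmetric X_rel.
Proof. by move=> y z; apply/asboolP/asboolP; exact: rst_sym. Qed.

Lemma X_rel_trans : transitive X_rel.
Proof.
move=> y x z /asboolP h1 /asboolP h2; apply/asboolP.
exact: rst_trans h1 h2.
Qed.

Canonical X_equiv := EquivRel X_rel X_rel_refl X_rel_sym X_rel_trans.

Lemma Xi_rel_refl : reflexive Xi_rel.
Proof. by move=> H; apply/asboolP; exists 1%g => x; rewrite conj_setE conjg1. Qed.

Lemma Xi_rel_symP H1 H2 : Xi_rel H1 H2 -> Xi_rel H2 H1.
Proof.
move=> /asboolP[g Hg]; apply/asboolP; exists g^-1%g => x.
by rewrite conj_setE -Hg conj_setE conjgKV.
Qed.

Lemma Xi_rel_sym : symmetric Xi_rel.
Proof. by move=> H1 H2; apply/idP/idP; exact: Xi_rel_symP. Qed.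

Lemma Xi_rel_trans : transitive Xi_rel.
Proof.
move=> H2 H1 H3 /asboolP[g Hg] /asboolP[h Hh]; apply/asboolP.
by exists (h * g)%g => x; rewrite conj_setE conjgM -Hh conj_setE -Hg.
Qed.

Canonical Xi_equiv := EquivRel Xi_rel Xi_rel_refl Xi_rel_sym Xi_rel_trans.

Definition X_space := {eq_quot X_equiv}.
HB.instance Definition _ := EqQuotient.on X_space.
HB.instance Definition _ := Choice.on X_space.

Definition Xi_space := {eq_quot Xi_equiv}.
HB.instance Definition _ := EqQuotient.on Xi_space.
HB.instance Definition _ := Choice.on Xi_space.

(* The natural map from X to Xi: by [X_to_XiE], the choice of a representative
   does not matter. *)
Definition X_to_Xi (x : X_space) : Xi_space := \pi_Xi_space (ip_ws (repr x)).

Lemma isolator_conj_sub g (A B : {pred G}) :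
  B =i conj_set g A -> {subset conj_set g (isolator A) <= isolator B}.
Proof.
move=> AB x /asboolP xA; apply/asboolP => L [BL rL].
have cl : group_closed (conj_set g^-1%g L).
  split=> [|u v]; rewrite !conj_setE ?conj1g ?gpred1// => uL vL.
  by rewrite conjMg conjVg gpredF.
pose C : subgroup G := Subgroup cl.
have: (x ^ g)%g \in C; last by rewrite conj_setE conjgK.
apply: xA; split=> [u uA|u i i0]; last first.
  by rewrite !conj_setE conjXg; exact: rL.
by rewrite conj_setE; apply: BL; rewrite AB conj_setE conjgKV.
Qed.

Lemma isolator_conj g (A B : {pred G}) :
  B =i conj_set g A -> conj_set g (isolator A) =i isolator B.
Proof.
move=> AB x; apply/idP/idP; first exact: isolator_conj_sub.
move=> xB; rewrite conj_setE; apply: (@isolator_conj_sub g^-1%g B A) => [y|].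
  by rewrite conj_setE AB conj_setE conjgKV.
by rewrite conj_setE conjgK.
Qed.

Lemma X_rel_Xi (y1 y2 : irr_pair) :
  X_rel y1 y2 -> Xi_rel (ip_ws y1) (ip_ws y2).
Proof.
move=> /asboolP; elim=> {y1 y2} [y1 y2|y|y1 y2 _|y1 y2 y3 _ h12 _ h23].
- case=> [e _|e _|g [e _]]; apply/asboolP; [exists 1%g|exists 1%g|exists g].
  + by apply: isolator_conj => x; rewrite conj_setE conjg1 -e.
  + by move=> x; rewrite conj_setE conjg1 e.
  + exact: isolator_conj.
- exact: Xi_rel_refl.
- exact: Xi_rel_symP.
- exact: Xi_rel_trans h12 h23.
Qed.

Lemma X_to_XiE (y : irr_pair) :
  X_to_Xi (\pi_X_space y) = \pi_Xi_space (ip_ws y).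
Proof. by apply/eqmodP/X_rel_Xi/eqmodP; rewrite reprK. Qed.

Definition Xi_ (r : nat * nat) : set Xi_space :=
  [set \pi_Xi_space H | H in
     [set H : weight_subgroup | has_rk1 H r.1 /\ has_rk2 H r.2]]%classic.

Definition X_ (r : nat * nat) : set X_space := (X_to_Xi @^-1` Xi_ r)%classic.

(* The disjoint union of the [X_ r] for [r] in [rs]. *)
Definition X_union (rs : seq (nat * nat)) : set ((nat * nat) * X_space) :=
  [set rx | rx.1 \in rs /\ X_ rx.1 rx.2]%classic.

End WeightPairs.

Section UnitriangularMatrices.
Variable n : nat.

Definition unitri : {pred 'M[int]_n.+1} :=
  [pred A : 'M[int]_n.+1 |
    [forall i : 'I_n.+1, forall j : 'I_n.+1, (j <= i)%N ==> (A i j == (i == j)%:R)]].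

Lemma unitriP (A : 'M[int]_n.+1) :
  reflect (forall i j : 'I_n.+1, (j <= i)%N -> A i j = (i == j)%:R)
          (A \in unitri).
Proof.
apply: (iffP forallP) => [h i j ij|h i].
  by move/forallP/(_ j)/implyP/(_ ij)/eqP: (h i).
by apply/forallP => j; apply/implyP => ij; apply/eqP/h.
Qed.

Let upper (k : nat) (A : 'M[int]_n.+1) :=
  forall i j : 'I_n.+1, (j < i + k)%N -> A i j = 0.

Let upperM k l A B : upper k A -> upper l B -> upper (k + l) (A * B).
Proof.
move=> hA hB i j ij; rewrite mxE big1 // => m _.
have [mi|im] := ltnP m (i + k); first by rewrite hA // mul0r.
by rewrite hB ?mulr0 // (leq_trans ij) // addnA leq_add2r.
Qed.

Let upperX A k : upper 1 A -> upper k (A ^+ k).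
Proof.
move=> hA; elim: k => [|k IH]; last by rewrite exprS -add1n; exact: upperM.
by move=> i j; rewrite addn0 expr0 mxE => ji; rewrite -val_eqE /= gtn_eqF.
Qed.

Let unitri_upper A : (A \in unitri) <-> upper 1 (1 - A).
Proof.
split=> [/unitriP h i j|h].
  by rewrite addn1 ltnS => ji; rewrite !mxE h // subrr.
apply/unitriP => i j ji; have := h i j; rewrite addn1 ltnS => /(_ ji).
by rewrite !mxE => /eqP; rewrite subr_eq0 => /eqP.
Qed.

Let upperD k A B : upper k A -> upper k B -> upper k (A + B).
Proof. by move=> hA hB i j ij; rewrite mxE hA // hB // addr0. Qed.

Let upperN k A : upper k A -> upper k (- A).
Proof. by move=> hA i j ij; rewrite mxE hA // oppr0. Qed.

Lemma unitri1 : (1 : 'M[int]_n.+1) \in unitri.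
Proof. by apply/unitri_upper => i j _; rewrite subrr mxE. Qed.

Lemma unitriM (A B : 'M[int]_n.+1) :
  A \in unitri -> B \in unitri -> A * B \in unitri.
Proof.
move=> hA /unitri_upper hB; apply/unitri_upper.
have -> : 1 - A * B = (1 - A) + A * (1 - B) by rewrite mulrBr mulr1 addrA subrK.
apply: upperD; first exact/unitri_upper.
apply: (upperM (k := 0) _ hB) => i j; rewrite addn0 => ji.
by rewrite (unitriP _ hA) ?(ltnW ji) // -val_eqE /= gtn_eqF.
Qed.

(* With [N = 1 - A] nilpotent, [A^-1] is the geometric sum of [N]. *)
Definition unitri_inv (A : 'M[int]_n.+1) : 'M[int]_n.+1 :=
  \sum_(k < n.+1) (1 - A) ^+ k.

Lemma unitri_invE (A : 'M[int]_n.+1) : A \in unitri -> A * unitri_inv A = 1.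
Proof.
move=> /unitri_upper /(@upperX _ n.+1) hA.
have N0 : (1 - A) ^+ n.+1 = 0.
  by apply/matrixP => i j; rewrite hA ?mxE // ltn_addl.
have := subrX1 (1 - A) n.+1; rewrite N0 sub0r -/(unitri_inv A) => /eqP.
by rewrite [1 - A]addrC addrK mulNr eqr_opp => /eqP.
Qed.

Lemma unitri_invP (A : 'M[int]_n.+1) : A \in unitri -> unitri_inv A \in unitri.
Proof.
move=> hA; apply/unitri_upper.
have -> : 1 - unitri_inv A = - ((1 - A) * \sum_(k < n) (1 - A) ^+ k).
  rewrite /unitri_inv big_ord_recl expr0 opprD addrA subrr add0r mulr_sumr.
  by congr (- _); apply: eq_bigr => k _; rewrite -exprS.
apply: upperN; rewrite mulr_sumr => i j ij.
rewrite summxE big1 // => k _; rewrite -exprS.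
apply: (upperX (k := k.+1) (proj1 (unitri_upper A) hA)).
by apply: leq_trans ij _; rewrite leq_add2l.
Qed.

Definition unitri_mx := {A : 'M[int]_n.+1 | A \in unitri}.

HB.instance Definition _ := SubType.on unitri_mx.
HB.instance Definition _ := Choice.on unitri_mx.

Definition unitri_mx1 : unitri_mx := exist _ 1 unitri1.
Definition unitri_mxM (A B : unitri_mx) : unitri_mx :=
  exist _ (val A * val B) (unitriM (valP A) (valP B)).
Definition unitri_mxV (A : unitri_mx) : unitri_mx :=
  exist _ (unitri_inv (val A)) (unitri_invP (valP A)).

Lemma unitri_mxA : associative unitri_mxM.
Proof. by move=> A B C; apply/val_inj/mulrA. Qed.
Lemma unitri_mx1M : left_id unitri_mx1 unitri_mxM.
Proof. by move=> A; apply/val_inj/mul1r. Qed.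
Lemma unitri_mxM1 : right_id unitri_mx1 unitri_mxM.
Proof. by move=> A; apply/val_inj/mulr1. Qed.
Lemma unitri_mxMV : right_inverse unitri_mx1 unitri_mxV unitri_mxM.
Proof. by move=> A; apply/val_inj/unitri_invE/valP. Qed.
Lemma unitri_mxVM : left_inverse unitri_mx1 unitri_mxV unitri_mxM.
Proof. by move=> A; apply/val_inj/mulmx1C/unitri_invE/valP. Qed.

HB.instance Definition _ := isGroup.Build unitri_mx
  unitri_mxA unitri_mx1M unitri_mxM1 unitri_mxVM unitri_mxMV.

End UnitriangularMatrices.

(* The 4 x 4 matrices: [unitri_mx n] has size n + 1. *)
Definition UT4 : groupType := unitri_mx 3.

(* Main.v *)
(* For a pair (H, chi) and a representation V, let V(H, chi) be the space of
   vectors on which H acts through chi.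

   Since UT4 is nilpotent, H is subnormal, and going up a subnormal chain one
   sees that ind chi is irreducible as soon as every y linked to (H, chi) lies
   in H: y is linked if it commensurates H into itself and chi, chi^y agree
   where both are defined.

   Let V be irreducible with V(H, chi) nonzero and finite-dimensional.
   Enlarging (H, chi) as long as some element normalising the pair is missing
   (it has an eigenvector in V(H, chi)) makes (H, chi) contain its stabiliser.
   If the centre acts through a character of infinite order, such a maximal H
   contains every y linked to it, because u^n in H implies u in H for u in
   [G, G].  If the central character has finite order, one first replaces
   (H, chi) by a pair containing [G, G], without increasing the dimension of
   the weight space; a linked y then normalises H.  In both cases
   V is ind chi by Frobenius reciprocity.

   Conversely, as C is uncountable and G is countable, Schur's lemma holds for
   an irreducible ind chi, whose (H, chi)-weight space is therefore a line; in
   particular H is its own stabiliser, which excludes all other ranks.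

   Finally, an isomorphism of induced representations produces linked elements
   in both directions; hence the isolators of the two subgroups are contained
   in conjugates of each other, and they are conjugate because a subgroup of a
   nilpotent group is never properly contained in a conjugate of itself. *)
Require Import Defs.
From mathcomp Require Import all_boot all_order all_algebra generic_quotient.
From mathcomp Require Import boolp classical_sets functions reals complex.
From mathcomp Require Import cardinality ring lra zify.

Set Implicit Arguments.
Unset Strict Implicit.
Unset Printing Implicit Defensive.

Import GRing.Theory.
Local Open Scope ring_scope.

(** * Free families and polynomials in an operator *)

Section FreeFamilies.
Variables (K : fieldType) (V : lmodType K).

Definition free_fam n (a : 'I_n -> V) :=
  forall c : 'I_n -> K, \sum_i c i *: a i = 0 -> forall i, c i = 0.

(** [E] is a bare predicate, so its dimension is bounded through the free families it contains. *)
Definition dim_le (E : V -> Prop) (n : nat) :=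
  forall m (a : 'I_m -> V), (forall i, E (a i)) -> free_fam a -> (m <= n)%N.

Lemma not_free_fam n (a : 'I_n -> V) : ~ free_fam a ->
  exists c : 'I_n -> K, (exists i, c i != 0) /\ \sum_i c i *: a i = 0.
Proof.
move=> /existsNP[c /not_implyP[ca /existsNP[i /eqP ci]]].
by exists c; split => //; exists i.
Qed.

Lemma mx_row_dep m n (A : 'M[K]_(m, n)) : (n < m)%N ->
  exists c : 'I_m -> K, (exists i, c i != 0) /\ forall j, \sum_i c i * A i j = 0.
Proof.
move=> nm.
have : kermx A != 0.
  rewrite -mxrank_eq0 mxrank_ker subn_eq0 -ltnNge.
  exact: leq_ltn_trans (rank_leq_col A) nm.
case/rowV0Pn => c /sub_kermxP cA c0.
exists (c 0); split; first by case/rV0Pn: c0 => i ci; exists i.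
move=> j; move/matrixP/(_ 0 j): cA; by rewrite !mxE.
Qed.

Lemma span_dim_le (E : V -> Prop) n (b : 'I_n -> V) :
  (forall v, E v -> exists c : 'I_n -> K, v = \sum_i c i *: b i) -> dim_le E n.
Proof.
move=> Eb m a Ea fa; rewrite leqNgt; apply/negP => nm.
have /choice[c ac] : forall i, exists c : 'I_n -> K, a i = \sum_j c j *: b j.
  by move=> i; exact: Eb.
have [d [[i di] dc]] := mx_row_dep (\matrix_(i, j) c i j) nm.
have /fa/(_ i)/eqP : \sum_i d i *: a i = 0; last by rewrite (negPf di).
under eq_bigr do rewrite ac scaler_sumr.
rewrite exchange_big big1 // => j _ /=.
under eq_bigr do rewrite scalerA.
rewrite -scaler_suml.
have := dc j; under eq_bigr do rewrite mxE.
by move=> ->; rewrite scale0r.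
Qed.

Lemma dim_le_sub (E F : V -> Prop) n :
  (forall v, E v -> F v) -> dim_le F n -> dim_le E n.
Proof. by move=> EF Fn m a Ea; apply: Fn => i; exact/EF. Qed.

(** Makes the dimension drop on passing to a proper subspace [F]: a relation involving [w] would put
    [w] in [F]. *)
Lemma free_fam_cons n (a : 'I_n -> V) (F : V -> Prop) w :
  (forall (c : 'I_n -> K), F (\sum_i c i *: a i)) ->
  (forall k v, F v -> F (k *: v)) -> ~ F w -> free_fam a ->
  free_fam (fun i : 'I_n.+1 => if unlift ord0 i is Some j then a j else w).
Proof.
move=> Fa FZ Fw fa c; rewrite big_ord_recl unlift_none.
under eq_bigr do rewrite liftK.
have [c0|c0 e] := eqVneq (c ord0) 0.
  rewrite c0 scale0r add0r => /fa ca i.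
  by have [j ->|->//] := unliftP ord0 i.
case: Fw; have -> : w = - (c ord0)^-1 *: \sum_i c (lift ord0 i) *: a i.
  rewrite scaleNr -scalerN -[LHS]scale1r -(mulVf c0) -scalerA; congr (_ *: _).
  by apply/eqP; rewrite -addr_eq0 e.
exact: FZ.
Qed.

End FreeFamilies.

(** * Polynomials in a linear operator *)

Section PolyAction.
Variables (K : fieldType) (V : lmodType K) (T : V -> V).
Hypothesis linT : linear T.

Let TD u v : T (u + v) = T u + T v.
Proof. by have := linT 1 u v; rewrite !scale1r. Qed.
Let T0 : T 0 = 0.
Proof. by apply: (addrI (T 0)); rewrite -TD !addr0. Qed.
Let TZ a u : T (a *: u) = a *: T u.
Proof. by have := linT a u 0; rewrite T0 !addr0. Qed.
Let Tsum (I : Type) (r : seq I) (F : I -> V) :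
  T (\sum_(i <- r) F i) = \sum_(i <- r) T (F i).
Proof. exact: (big_morph T TD T0). Qed.

(** This is $p(T)v$. *)
Definition pact (p : {poly K}) (v : V) : V := \sum_(i < size p) p`_i *: iter i T v.

Lemma pactE n (p : {poly K}) v : (size p <= n)%N ->
  pact p v = \sum_(i < n) p`_i *: iter i T v.
Proof.
move=> pn; rewrite /pact -!(big_mkord xpredT (fun i => p`_i *: iter i T v)).
rewrite (big_cat_nat (n := size p) _ pn) //=.
rewrite [X in _ = _ + X]big_nat_cond [X in _ = _ + X]big1 ?addr0 // => i /andP[/andP[pi _] _].
by rewrite nth_default ?scale0r.
Qed.

Lemma pactD p q v : pact (p + q) v = pact p v + pact q v.
Proof.
pose n := maxn (size p) (size q).
rewrite (@pactE n) ?size_polyD // (@pactE n p) ?leq_maxl // (@pactE n q) ?leq_maxr //.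
by rewrite -big_split /=; apply: eq_bigr => i _; rewrite coefD scalerDl.
Qed.

Lemma pactZ a p v : pact (a *: p) v = a *: pact p v.
Proof.
rewrite (@pactE (size p)) ?size_scale_leq // scaler_sumr.
by apply: eq_bigr => i _; rewrite coefZ scalerA.
Qed.

Lemma pact_sum (I : Type) (r : seq I) (F : I -> {poly K}) v :
  pact (\sum_(i <- r) F i) v = \sum_(i <- r) pact (F i) v.
Proof.
apply: (big_morph (pact^~ v)) => [p q|]; first exact: pactD.
by rewrite /pact size_poly0 big_ord0.
Qed.

Lemma pact1 v : pact 1 v = v.
Proof. by rewrite /pact size_poly1 big_ord1 coef1 scale1r. Qed.

Lemma pactX p v : pact (p * 'X) v = T (pact p v).
Proof.
rewrite (@pactE (size p).+1) ?(leq_trans (size_polyMleq _ _)) ?size_polyX ?addn2 //.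
rewrite big_ord_recl coefMX eqxx scale0r add0r Tsum.
by apply: eq_bigr => i _; rewrite coefMX /= TZ.
Qed.

Lemma pactMXsubC p c v : pact (p * ('X - c%:P)) v = T (pact p v) - c *: pact p v.
Proof. by rewrite mulrBr pactD pactX mulrC mul_polyC -!scaleNr pactZ. Qed.

Lemma pact_T p v : pact p (T v) = T (pact p v).
Proof.
by rewrite /pact Tsum; apply: eq_bigr => i _; rewrite TZ -iterSr.
Qed.

Lemma pact_linear p : linear (pact p).
Proof.
move=> a u v; rewrite /pact scaler_sumr -big_split /=; apply: eq_bigr => i _.
rewrite scalerA mulrC -scalerA -scalerDr; congr (_ *: _).
by elim: (val i) => //= n ->; rewrite TD TZ.
Qed.

(* The last nonzero vector among the partial products applied to [v] is an
   eigenvector. *)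
Lemma eigen_of_prod (s : seq K) (E : V -> Prop) v :
  (forall a w, E w -> E (T w - a *: w)) -> E v -> v != 0 ->
  pact (\prod_(a <- s) ('X - a%:P)) v = 0 ->
  exists w a, [/\ E w, w != 0, a \in s & T w = a *: w].
Proof.
move=> ET Ev v0; elim: s => [|a s IH];
  first by rewrite big_nil pact1 => /eqP; rewrite (negPf v0).
rewrite big_cons mulrC pactMXsubC.
set u := pact _ v; have Eu : E u.
  rewrite /u; elim: s {u IH} => [|b s IH]; first by rewrite big_nil pact1.
  by rewrite big_cons mulrC pactMXsubC; exact: ET.
have [u0 _|u0 /eqP] := eqVneq u 0.
  by have [w [b [? ? bs ?]]] := IH u0; exists w, b; split; rewrite // inE bs orbT.
by rewrite subr_eq0 => /eqP Tu; exists u, a; split; rewrite // inE eqxx.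
Qed.

End PolyAction.

Section Eigenvector.
Variables (K : closedFieldType) (V : lmodType K) (T : V -> V).
Hypothesis linT : linear T.

(** The [n + 1] vectors $v, Tv, \dots, T^n v$ of [E] are dependent, so a nonzero polynomial in [T]
    kills [v]; it splits over [K], and [eigen_of_prod] applies. *)
Lemma dim_le_eigen (E : V -> Prop) n v : dim_le E n ->
  (forall a w u, E w -> E u -> E (a *: w + u)) -> (forall w, E w -> E (T w)) ->
  E v -> v != 0 -> exists w a, [/\ E w, w != 0 & T w = a *: w].
Proof.
move=> En Elin ET Ev v0.
have Ei i : E (iter i T v) by elim: i => //= i; exact: ET.
have nf : ~ free_fam (fun i : 'I_n.+1 => iter i T v).
  by move=> /(En _ _ (fun i => Ei i)); rewrite ltnn.
have [c [[i ci] cv]] := not_free_fam nf.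
pose p := \poly_(i < n.+1) (if insub i is Some j then c j else 0).
have pi (j : 'I_n.+1) : p`_j = c j by rewrite coef_poly ltn_ord valK.
have p0 : p != 0 by apply: contraNneq ci => p0; rewrite -pi p0 coef0.
have pv : pact T p v = 0.
  rewrite (@pactE _ _ _ n.+1) ?size_poly // -[RHS]cv.
  by apply: eq_bigr => j _; rewrite pi.
have [s ps] := closed_field_poly_normal p.
move: pv; rewrite ps pactZ => /eqP; rewrite scaler_eq0 lead_coef_eq0 (negPf p0) /=.
move=> /eqP /(eigen_of_prod linT (E := E))[]// => [a w Ew|w [a [? ? _ ?]]]; last by exists w, a.
by rewrite addrC -scaleNr; apply: Elin => //; exact: ET.
Qed.

End Eigenvector.

(** * Weight spaces *)

Section RepTheory.
Variables (G : groupType) (K : fieldType).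
Implicit Types (V W : representation G K) (H : subgroup G).

Section Act.
Variable V : representation G K.
Implicit Types (u v w : V).

Lemma rep_actD g u v : rep_act g (u + v) = rep_act g u + rep_act g v.
Proof. by have := rep_linear g 1 u v; rewrite !scale1r. Qed.

Lemma rep_act0 g : rep_act g (0 : V) = 0.
Proof. by apply: (addrI (rep_act g 0)); rewrite -rep_actD !addr0. Qed.

Lemma rep_actZ g a v : rep_act g (a *: v) = a *: rep_act g v.
Proof. by have := rep_linear g a v 0; rewrite rep_act0 !addr0. Qed.

Lemma rep_act_sum (I : Type) (r : seq I) g (F : I -> V) :
  rep_act g (\sum_(i <- r) F i) = \sum_(i <- r) rep_act g (F i).
Proof. exact: (big_morph _ (rep_actD g) (rep_act0 g)). Qed.

Lemma rep_actK g : cancel (@rep_act _ _ V g) (rep_act g^-1%g).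
Proof. by move=> v; rewrite -rep_actM mulVg rep_act1. Qed.

Lemma rep_actVK g : cancel (@rep_act _ _ V g^-1%g) (rep_act g).
Proof. by move=> v; rewrite -rep_actM mulgV rep_act1. Qed.

Lemma rep_act_eq0 g v : (rep_act g v == 0) = (v == 0).
Proof.
apply/eqP/eqP => [|->]; last exact: rep_act0.
by move=> /(congr1 (rep_act g^-1%g)); rewrite rep_actK rep_act0.
Qed.

Lemma rep_act_swap g h v : rep_act g (rep_act h v) = rep_act h (rep_act (g ^ h)%g v).
Proof. by rewrite -!rep_actM conjgE mulVKg. Qed.

End Act.

Lemma subg_val H x : x \in H -> exists h : subg_of H, x = val h.
Proof. by move=> xH; exists (exist _ x xH). Qed.

Section CharExt.
Variables (H : subgroup G) (chi : character K H).

(** Extension of [chi] by zero: evaluation then needs no membership proof, and nonvanishing encodes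
    membership in [H]. *)
Definition char_ext (x : G) : K := oapp chi 0 (insub x).

Lemma char_ext_val (h : subg_of H) : char_ext (val h) = chi h.
Proof. by rewrite /char_ext valK. Qed.

Lemma char_ext_out x : x \notin H -> char_ext x = 0.
Proof. by move=> xH; rewrite /char_ext insubN. Qed.

Lemma char_extM x y : x \in H -> char_ext (x * y)%g = char_ext x * char_ext y.
Proof.
move=> xH; have [yH|yH] := boolP (y \in H); last first.
  by rewrite [char_ext y]char_ext_out // mulr0 char_ext_out // gpredMl.
have [h ->] := subg_val xH; have [k ->] := subg_val yH.
by rewrite -valM !char_ext_val char_mul.
Qed.

Lemma char_ext_eq0 x : (char_ext x == 0) = (x \notin H).
Proof.
have [xH|xH] := boolP (x \in H); last by rewrite char_ext_out ?eqxx.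
have [h ->] := subg_val xH.
by rewrite char_ext_val (negPf (char_neq0 _ _)).
Qed.

Lemma char_ext1 : char_ext 1%g = 1.
Proof. by rewrite -(character1 chi) -char_ext_val val1. Qed.

Lemma char_extV x : x \in H -> char_ext x^-1%g = (char_ext x)^-1.
Proof.
move=> xH; apply: (mulfI (x := char_ext x)); first by rewrite char_ext_eq0 xH.
by rewrite -char_extM // mulgV char_ext1 divff // char_ext_eq0 xH.
Qed.

Lemma char_extJ x y : x \in H -> y \in H -> char_ext (x ^ y)%g = char_ext x.
Proof.
move=> xH yH; rewrite conjgE char_extM ?gpredV // char_extM // char_extV //.
by rewrite mulrC mulfK // char_ext_eq0 yH.
Qed.

End CharExt.

(** The weight space V(H, chi). *)
Definition wt V H (chi : character K H) (v : V) :=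
  forall h, h \in H -> rep_act h v = char_ext chi h *: v.

Lemma wtZD V H (chi : character K H) a (u v : V) :
  wt chi u -> wt chi v -> wt chi (a *: u + v).
Proof.
by move=> cu cv h hH; rewrite rep_actD rep_actZ cu // cv // scalerDr !scalerA mulrC.
Qed.

Lemma mk_character H (f : G -> K) : (forall x, x \in H -> f x != 0) ->
  (forall x y, x \in H -> y \in H -> f (x * y)%g = f x * f y) ->
  exists chi : character K H, forall x, x \in H -> char_ext chi x = f x.
Proof.
move=> f0 fM.
have c0 (x : subg_of H) : f (val x) != 0 by apply/f0/valP.
have cM (x y : subg_of H) : f (val (x * y)%g) = f (val x) * f (val y).
  by rewrite valM; apply: fM; exact: valP.
exists (Character c0 cM) => x xH.
have [h ->] := subg_val xH.
by rewrite char_ext_val.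
Qed.

Lemma mk_subgroup (P : G -> Prop) : P 1%g ->
  (forall x y, P x -> P y -> P (x * y)%g) -> (forall x, P x -> P x^-1%g) ->
  exists H : subgroup G, forall x, x \in H <-> P x.
Proof.
move=> P1 PM PV.
have cl : group_closed [pred x | `[< P x >]].
  split=> [|x y /asboolP Px /asboolP Py]; first exact/asboolP.
  by apply/asboolP/PM => //; exact: PV.
by exists (Subgroup cl) => x; split=> [/asboolP|Px]; last exact/asboolP.
Qed.

(** The elements acting on [E] by scalars form a subgroup, and the scalar, unique because [v0] is
    nonzero, is a character of it. Pairs are enlarged in this way. *)
Lemma scalar_pair V (E : V -> Prop) v0 : E v0 -> v0 != 0 ->
  exists H (chi : character K H),
    (forall g, g \in H <-> exists c, forall w, E w -> rep_act g w = c *: w) /\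
    forall w, E w -> wt chi w.
Proof.
move=> E0 v0N.
have inj a b : a *: v0 = b *: v0 -> a = b.
  by move/eqP; rewrite -subr_eq0 -scalerBl scaler_eq0 (negPf v0N) orbF subr_eq0 => /eqP.
pose P g := exists c, forall w, E w -> rep_act g w = c *: w.
have [||x [c cE]|H HP] := @mk_subgroup P.
- by exists 1 => w _; rewrite rep_act1 scale1r.
- move=> x y [c cE] [d dE]; exists (c * d) => w Ew.
  by rewrite rep_actM dE // rep_actZ cE // scalerA mulrC.
- have c0 : c != 0.
    by apply: contra_eq_neq (cE _ E0) => ->; rewrite scale0r rep_act_eq0.
  exists c^-1 => w Ew; rewrite -[in LHS](scalerK c0 w) -cE // rep_actZ.
  by rewrite rep_actK.
have /choice[f fP] : forall g, exists c, g \in H -> forall w, E w -> rep_act g w = c *: w.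
  move=> g; have [/HP[c cE]|gH] := boolP (g \in H); first by exists c.
  by exists 0.
have [|x y xH yH|chi chiE] := @mk_character H f.
- move=> x xH; apply: contra_eq_neq (fP _ xH _ E0) => ->.
  by rewrite scale0r rep_act_eq0.
- apply: inj; rewrite -fP ?gpredM // rep_actM (fP y) // rep_actZ fP // scalerA.
  by rewrite mulrC.
exists H, chi; split=> // w Ew h hH.
by rewrite chiE // -fP.
Qed.

End RepTheory.

Section MaximalWeights.
Variables (G : groupType) (K : closedFieldType) (V : representation G K).

(* If [y] normalises the pair but does not act by a scalar on the weight space,
   an eigenspace of [y] is a smaller weight space. *)
Lemma max_weight n (H : subgroup G) (chi : character K H) (v : V) :
  wt chi v -> v != 0 -> dim_le (wt (V := V) chi) n ->
  exists (H' : subgroup G) (chi' : character K H'),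
    [/\ {subset H <= H'}, exists2 u : V, wt chi' u & u != 0,
        exists m, dim_le (wt (V := V) chi') m
      & forall y, (forall h, h \in H' -> (h ^ y)%g \in H' /\
           char_ext chi' (h ^ y)%g = char_ext chi' h) -> y \in H'].
Proof.
elim: n H chi v => [|n IH] H chi v Ev v0 En.
  have : (1 <= 0)%N; last by [].
  apply: (En _ (fun=> v)) => // c; rewrite big_ord1 => /eqP.
  by rewrite scaler_eq0 (negPf v0) orbF => /eqP c0 i; rewrite ord1.
(* Pass to the largest pair with the same weight space. *)
have [H1 [chi1 [H1P wt1]]] := scalar_pair (E := wt chi) Ev v0.
have HH1 : {subset H <= H1}.
  by move=> h hH; apply/H1P; exists (char_ext chi h) => w /(_ h hH).
have chi1E h : h \in H -> char_ext chi1 h = char_ext chi h.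
  move=> hH; have := wt1 _ Ev h (HH1 _ hH); rewrite Ev // => /eqP.
  by rewrite -subr_eq0 -scalerBl scaler_eq0 (negPf v0) orbF subr_eq0 => /eqP.
have wtE (w : V) : wt chi1 w -> wt chi w.
  by move=> cw h hH; rewrite cw ?HH1 // chi1E.
have [|/existsNP[y /not_implyP[yN yH1]]] := pselect (forall y,
  (forall h, h \in H1 -> (h ^ y)%g \in H1 /\
     char_ext chi1 (h ^ y)%g = char_ext chi1 h) -> y \in H1).
  exists H1, chi1; split => //; first by exists v => //; exact: wt1.
  by exists n.+1; exact: dim_le_sub wtE En.
have yE (w : V) : wt chi w -> wt chi (rep_act y w).
  move=> /wt1 cw; apply: wtE => h hH; have [hy chy] := yN h hH.
  by rewrite rep_act_swap cw // chy rep_actZ.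
have [w [a [Ew w0 yw]]] := dim_le_eigen (rep_linear y) En (@wtZD _ _ _ _ _) yE Ev v0.
pose E' (u : V) := wt chi u /\ rep_act y u = a *: u.
have E'w : E' w by [].
have [H2 [chi2 [H2P wt2]]] := scalar_pair (E := E') E'w w0.
have HH2 : {subset H <= H2}.
  by move=> h hH; apply/H2P; exists (char_ext chi h) => u [/(_ h hH)].
have yH2 : y \in H2 by apply/H2P; exists a => u [].
have injw (c d : K) : c *: w = d *: w -> c = d.
  by move/eqP; rewrite -subr_eq0 -scalerBl scaler_eq0 (negPf w0) orbF subr_eq0 => /eqP.
have wtE' (u : V) : wt chi2 u -> E' u.
  move=> cu; split=> [h hH|].
    by rewrite cu ?HH2 //; congr (_ *: _); apply: injw; rewrite -wt2 ?HH2 // Ew.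
  by rewrite cu //; congr (_ *: _); apply: injw; rewrite -wt2.
have [|H' [chi' [s12 ? ? ?]]] := IH H2 chi2 w (wt2 _ E'w) w0.
  apply: dim_le_sub wtE' _ => m b bE' fb.
  (* As [y] lies outside [H1], it is not the scalar [a] on the whole weight space: the eigenspace
     [E'] is proper, and the dimension drops. *)
  have [u Eu E'u] : exists2 u : V, wt chi u & ~ E' u.
    apply: contrapT => nu; apply: yH1; apply/H1P; exists a => u Eu.
    by apply: contrapT => yu; apply: nu; exists u => // -[].
  rewrite -ltnS; apply: (En _ _ _ (free_fam_cons (F := E') _ _ E'u fb)).
  - by move=> i; case: unliftP => [j _|_] //; case: (bE' j).
  - move=> c; apply: (big_ind E').
    + by split=> [h _|]; rewrite !(scaler0, rep_act0).
    + move=> p q [p1 p2] [q1 q2]; split; last by rewrite rep_actD p2 q2 scalerDr.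
      by rewrite -[p]scale1r; exact: wtZD.
    + move=> i _; case: (bE' i) => b1 b2; split; last by rewrite rep_actZ b2 !scalerA mulrC.
      by move=> h hH; rewrite rep_actZ b1 // !scalerA mulrC.
  - move=> k p [p1 p2]; split; last by rewrite rep_actZ p2 !scalerA mulrC.
    by move=> h hH; rewrite rep_actZ p1 // !scalerA mulrC.
by exists H', chi'; split => // h /HH2/s12.
Qed.

End MaximalWeights.

(** * Induced representations *)

Section Intertwiners.
Variables (G : groupType) (K : fieldType).
Implicit Types V W : representation G K.

Lemma intertwinersD V W (phi : V -> W) : intertwiners phi -> {morph phi : u v / u + v}.
Proof. by move=> [l _] u v; have := l 1 u v; rewrite !scale1r. Qed.

Lemma intertwiners0 V W (phi : V -> W) : intertwiners phi -> phi 0 = 0.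
Proof. by move=> l; apply: (addrI (phi 0)); rewrite -(intertwinersD l) !addr0. Qed.

Lemma intertwinersZ V W (phi : V -> W) : intertwiners phi -> forall a u, phi (a *: u) = a *: phi u.
Proof. by move=> l a u; have := l.1 a u 0; rewrite (intertwiners0 l) !addr0. Qed.

Lemma intertwiners_comp V W (X : representation G K) (phi : V -> W) (psi : W -> X) :
  intertwiners phi -> intertwiners psi -> intertwiners (psi \o phi).
Proof.
move=> [l1 e1] [l2 e2]; split=> [a u v|g v] /=; first by rewrite l1 l2.
by rewrite e1 e2.
Qed.

Lemma rep_iso_refl V : rep_iso V V.
Proof. by exists id; [split | exists id]. Qed.

Lemma rep_iso_sym V W : rep_iso V W -> rep_iso W V.
Proof.
move=> [phi [l e] [psi k1 k2]]; exists psi; last by exists phi.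
split=> [a u v|g v]; apply: (can_inj k1); rewrite ?l ?e !k2 //.
Qed.

Lemma rep_iso_trans V W (X : representation G K) : rep_iso V W -> rep_iso W X -> rep_iso V X.
Proof.
move=> [phi tw1 b1] [psi tw2 b2]; exists (psi \o phi); first exact: intertwiners_comp.
exact: bij_comp.
Qed.

Lemma irreducible_all V (W : V -> Prop) v : irreducible V ->
  (forall a u w, W u -> W w -> W (a *: u + w)) ->
  (forall g u, W u -> W (rep_act g u)) -> W v -> v != 0 -> forall u, W u.
Proof.
move=> [_ irr] Wl Wg Wv v0 u.
have [|g w /asboolP Ww|/(_ v)|/(_ u)] := irr [pred w | `[< W w >]].
- split=> [|a x y /asboolP Wx /asboolP Wy]; apply/asboolP; last exact: Wl.
  by have := Wl (-1) _ _ Wv Wv; rewrite scaleN1r addNr.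
- by apply/asboolP; exact: Wg.
- by rewrite !inE (negPf v0) => /asboolP.
- by rewrite !inE => /asboolP.
Qed.

(** The kernel and the image are invariant subspaces, the first proper and the second nonzero. *)
Lemma irr_intertwiner_bij V W (phi : V -> W) v : irreducible V -> irreducible W ->
  intertwiners phi -> phi v != 0 -> bijective phi.
Proof.
move=> iV iW tw pv.
have inj u : phi u = 0 -> u = 0.
  move=> pu; apply/eqP; apply: contraNT pv => u0; apply/eqP.
  apply: (irreducible_all (W := fun u => phi u = 0) iV _ _ pu u0) => [a x y|g x].
    by rewrite (intertwinersD tw) (intertwinersZ tw) => -> ->; rewrite scaler0 addr0.
  by rewrite tw.2 => ->; rewrite rep_act0.
have sur w : exists u, phi u = w.
  apply: (irreducible_all (W := fun w => exists u, phi u = w) iW _ _ _ pv); last by exists v.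
    by move=> a x y [x' <-] [y' <-]; exists (a *: x' + y'); rewrite tw.1.
  by move=> g x [x' <-]; exists (rep_act g x'); rewrite tw.2.
have /choice[psi psiK] := sur; exists psi => // u.
apply/eqP; rewrite -subr_eq0; apply/eqP/inj.
by rewrite -scaleN1r (intertwinersD tw) (intertwinersZ tw) psiK scaleN1r subrr.
Qed.

Lemma irreducible_iso V W : rep_iso V W -> irreducible V -> irreducible W.
Proof.
move=> iso iV; have [phi tw [psi k1 k2]] := iso; split.
  have [[v v0] _] := iV; exists (phi v); apply: contraNneq v0 => pv.
  by apply/eqP/(can_inj k1); rewrite pv (intertwiners0 tw).
move=> P [P0 Pl] Pg; have [_ /(_ [pred v | phi v \in P])] := iV.
case.
- split=> [|a u v]; rewrite !inE; first by rewrite (intertwiners0 tw).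
  by move=> ? ?; rewrite tw.1; exact: Pl.
- by move=> g v; rewrite !inE tw.2; exact: Pg.
- move=> e; left => w; have := e (psi w); rewrite !inE k2 => ->.
  apply/eqP/eqP => [w0|->]; first by rewrite -(k2 w) w0 (intertwiners0 tw).
  by apply: (can_inj k1); rewrite k2 (intertwiners0 tw).
- by move=> e; right => w; have := e (psi w); rewrite !inE k2.
Qed.

End Intertwiners.

(** * Structure of induced representations and Frobenius reciprocity *)

Section Frobenius.
Variables (G : groupType) (K : fieldType) (H : subgroup G) (chi : character K H).
Local Notation I := (ind_rep chi).
Implicit Types (f : I) (x y g h t : G).

(* [K^o] is hidden from unification, which would otherwise look for scalars
   in it. *)
Definition ival f x : K := f x.

Lemma ind_mulL f h x : h \in H -> ival f (h * x)%g = char_ext chi h * ival f x.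
Proof.
move=> /subg_val[k ->]; case: f => f fP; rewrite /ival /=; have /asboolP[e _] := fP.
by rewrite e char_ext_val.
Qed.

Lemma ind_supp f : exists s : seq G, forall x, ival f x != 0 ->
  exists2 g, g \in s & (x / g)%g \in H.
Proof. by case: f => f fP; rewrite /ival /=; have /asboolP[_ e] := fP. Qed.

Lemma ind_mk (F : G -> K) :
  (forall h x, h \in H -> F (h * x)%g = char_ext chi h * F x) ->
  (exists s : seq G, forall x, F x != 0 -> exists2 g, g \in s & (x / g)%g \in H) ->
  exists f, forall x, ival f x = F x.
Proof.
move=> Fh Fs; have P : (F : G -> K^o) \in ind_pred chi.
  by apply/asboolP; split=> // h x; rewrite Fh ?char_ext_val //; exact: valP.
by exists (IndSpace P).
Qed.

Lemma ind_actE g f x : ival (rep_act g f) x = ival f (x * g)%g.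
Proof. by []. Qed.

Lemma ind_ext f1 f2 : (forall x, ival f1 x = ival f2 x) -> f1 = f2.
Proof. by move=> e; apply/val_inj/funext. Qed.

Lemma ind_val0 x : ival 0 x = 0. Proof. by []. Qed.
Lemma ind_valD f1 f2 x : ival (f1 + f2) x = ival f1 x + ival f2 x. Proof. by []. Qed.
Lemma ind_valZ a f x : ival (a *: f) x = a * ival f x. Proof. by []. Qed.

Lemma ind_val_sum (J : Type) (r : seq J) (F : J -> I) x :
  ival (\sum_(i <- r) F i) x = \sum_(i <- r) ival (F i) x.
Proof. exact: (big_morph (fun f : I => ival f x) (fun f1 f2 => ind_valD f1 f2 x)). Qed.

Lemma ind_neq0 f : f != 0 -> exists x, ival f x != 0.
Proof.
move=> f0; apply: contrapT => nx; case/negP: f0; apply/eqP/ind_ext => x.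
by apply/eqP; apply: contrapT => /negP fx; apply: nx; exists x.
Qed.

Lemma delta_subproof : (char_ext chi : G -> K^o) \in ind_pred chi.
Proof.
apply/asboolP; split=> [h x|]; first by rewrite char_extM ?char_ext_val //; exact: valP.
exists [:: 1%g] => x fx; exists 1%g; rewrite ?inE // divg1.
by apply: contraNT fx => xH; apply/eqP; exact: (char_ext_out chi xH).
Qed.

(** The generator $1 \otimes 1$ of $K[G] \otimes_{K[H]} K_\chi$, seen as a function. *)
Definition delta : I := IndSpace delta_subproof.

Lemma deltaE x : ival delta x = char_ext chi x. Proof. by []. Qed.

Lemma delta_neq0 : delta != 0.
Proof.
apply/eqP => /(congr1 (ival^~ 1%g)); rewrite deltaE ind_val0 char_ext1.
by apply/eqP/oner_neq0.
Qed.

Lemma delta_wt : wt chi delta.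
Proof.
move=> h hH; apply: ind_ext => x; rewrite ind_actE ind_valZ !deltaE.
have [xH|xH] := boolP (x \in H); first by rewrite char_extM // mulrC.
by rewrite [char_ext chi x]char_ext_out // mulr0 char_ext_out // gpredMr.
Qed.

(** [choose] depends only on the predicate once its default satisfies it, so this picks one element
    of each coset $Hx$. *)
Definition coset_rep x : G := choose (fun y => (y / x)%g \in H) x.

Lemma coset_repP x : (coset_rep x / x)%g \in H.
Proof. by apply: (@chooseP _ (fun y => (y / x)%g \in H)); rewrite mulgV gpred1. Qed.

Lemma coset_rep_eq x y : (x / y)%g \in H -> coset_rep x = coset_rep y.
Proof.
move=> xy; have e : (fun z => (z / x)%g \in H) =1 (fun z => (z / y)%g \in H).
  by move=> z; rewrite -[(z / y)%g](divgKA x) [RHS]gpredMr.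
rewrite /coset_rep (eq_choose e); apply: choose_id => //.
by rewrite mulgV gpred1.
Qed.

Lemma coset_rep_eqP x y : coset_rep x = coset_rep y -> (x / y)%g \in H.
Proof.
move=> e; rewrite -(divgKA (coset_rep x)) {2}e.
by rewrite gpredM ?coset_repP // gpredFC coset_repP.
Qed.

(** The chosen representatives of finitely many cosets containing the support of [f]; sums over
    $H\backslash G$ become finite sums over [s]. *)
Definition covers (s : seq G) f := [/\ uniq s, forall t, t \in s -> coset_rep t = t
  & forall x, ival f x != 0 -> coset_rep x \in s].

Lemma coset_rep_id x : coset_rep (coset_rep x) = coset_rep x.
Proof. exact/coset_rep_eq/coset_repP. Qed.

Lemma covers_ex (fs : seq I) : exists s, forall f, f \in fs -> covers s f.
Proof.
have [s sP] : exists s : seq G, forall f, f \in fs -> forall x, ival f x != 0 ->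
    exists2 g, g \in s & (x / g)%g \in H.
  elim: fs => [|f fs [s sP]]; first by exists [::].
  have [t tP] := ind_supp f; exists (t ++ s) => f'.
  rewrite inE => /predU1P[->|f's] x fx.
    by have [g gt xg] := tP x fx; exists g; rewrite ?mem_cat ?gt.
  by have [g gt xg] := sP _ f's x fx; exists g; rewrite ?mem_cat ?gt ?orbT.
exists (undup (map coset_rep s)) => f ffs; split; first exact: undup_uniq.
  by move=> t; rewrite mem_undup => /mapP[x _ ->]; exact: coset_rep_id.
move=> x /(sP _ ffs)[g gs xg]; rewrite mem_undup (coset_rep_eq xg).
exact: map_f.
Qed.

Lemma covers_sum (A : nmodType) s s' f (F : G -> A) : covers s f -> covers s' f ->
  (forall x, ival f x = 0 -> F x = 0) -> \sum_(t <- s) F t = \sum_(t <- s') F t.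
Proof.
move=> [us rs cs] [us' rs' cs'] F0.
have E (r : seq G) : \sum_(t <- r) F t = \sum_(t <- [seq t <- r | ival f t != 0]) F t.
  rewrite big_filter [RHS]big_mkcond; apply: eq_bigr => t _.
  by case: eqP => // /F0.
rewrite (E s) (E s'); apply: perm_big; apply: uniq_perm; rewrite ?filter_uniq //.
move=> t; rewrite !mem_filter; case: eqP => //= /eqP ft.
by apply/idP/idP => [/rs|/rs'] <-; [exact: cs'|exact: cs].
Qed.

(** The translate of [delta] by $t^{-1}$ is supported on $Ht$ and equals 1 at $t$. *)
Lemma ind_expand s f : covers s f ->
  f = \sum_(t <- s) ival f t *: rep_act t^-1%g delta.
Proof.
move=> [us rs cs]; apply: ind_ext => x; rewrite ind_val_sum.
have E t : ival (ival f t *: rep_act t^-1%g delta) x = ival f t * char_ext chi (x / t)%g by [].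
under eq_bigr do rewrite E.
have xr : (x / coset_rep x)%g \in H by rewrite gpredFC coset_repP.
have fx : ival f x = ival f (coset_rep x) * char_ext chi (x / coset_rep x)%g.
  by rewrite mulrC -ind_mulL // mulgVK.
have out t : t \in s -> t != coset_rep x -> char_ext chi (x / t)%g = 0.
  move=> ts tx; apply: char_ext_out; apply: contra tx => /coset_rep_eq ->.
  by rewrite rs.
have [xs|xs] := boolP (coset_rep x \in s).
  rewrite (bigD1_seq (coset_rep x)) //= -fx big_seq_cond big1 ?addr0 //.
  by move=> t /andP[ts tx]; rewrite out ?mulr0.
have -> : ival f x = 0 by apply/eqP; apply: contraNT xs => /cs.
rewrite big_seq big1 // => t ts; rewrite out ?mulr0 //.
by apply: contraNneq xs => <-.
Qed.

Lemma ind_generated (W : I -> Prop) :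
  (forall a u w, W u -> W w -> W (a *: u + w)) ->
  (forall g u, W u -> W (rep_act g u)) -> W delta -> forall f, W f.
Proof.
move=> Wl Wg Wd f; have [s /(_ f)] := covers_ex [:: f].
rewrite inE eqxx => /(_ isT) /ind_expand ->.
have W0 : W 0 by have := Wl (-1) _ _ Wd Wd; rewrite scaleN1r addNr.
apply: big_ind => // [u v Wu Wv|t _]; first by rewrite -[u]scale1r; exact: Wl.
by rewrite -[_ *: _]addr0; apply: Wl => //; exact: Wg.
Qed.

Lemma ind_intertwiners_eq (V : representation G K) (phi psi : I -> V) :
  intertwiners phi -> intertwiners psi ->
  phi delta = psi delta -> phi =1 psi.
Proof.
move=> tw1 tw2 e; apply: ind_generated => // [a u w e1 e2|g u e1].
  by rewrite tw1.1 tw2.1 e1 e2.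
by rewrite tw1.2 tw2.2 e1.
Qed.

(** The map is $f \mapsto \sum_{t \in H\backslash G} f(t)\, t^{-1} w$; each term depends only on the
    coset of $t$ because [w] is a weight vector. *)
Lemma frobenius (V : representation G K) (w : V) : wt chi w ->
  exists2 phi : I -> V, intertwiners phi & phi delta = w.
Proof.
move=> cw; pose term f x := ival f x *: rep_act x^-1%g w.
have term_eq f x y : (x / y)%g \in H -> term f x = term f y.
  move=> xy; rewrite /term -{1}(mulgVK y x) ind_mulL // mulrC -scalerA.
  congr (_ *: _); rewrite -rep_actZ -cw // -rep_actM; congr (rep_act _ _).
  by rewrite mulgA mulVg mul1g.
have term0 f x : ival f x = 0 -> term f x = 0 by rewrite /term => ->; rewrite scale0r.
have /choice[S SP] : forall f, exists s, covers s f.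
  by move=> f; have [s /(_ f)] := covers_ex [:: f]; rewrite inE eqxx; exists s; auto.
pose phi f := \sum_(t <- S f) term f t.
have phiE s f : covers s f -> phi f = \sum_(t <- s) term f t.
  by move=> cs; apply: covers_sum (SP f) cs _ => x; exact: term0.
exists phi; first split=> [a u v|g f].
- have [s sP] := covers_ex [:: u; v; a *: u + v].
  have [cu cv] : covers s u /\ covers s v by split; apply: sP; rewrite !inE eqxx ?orbT.
  have cuv : covers s (a *: u + v) by apply: sP; rewrite !inE eqxx ?orbT.
  rewrite (phiE _ _ cu) (phiE _ _ cv) (phiE _ _ cuv) scaler_sumr -big_split /=.
  apply: eq_bigr => t _.
  by rewrite /term ind_valD ind_valZ scalerDl scalerA.
- have [us rs cs] := SP (rep_act g f); set s := S _ in us rs cs *.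
  (* Replacing $Ht$ by $Htg$ turns a cover of [rep_act g f] into a cover of [f]. *)
  rewrite (phiE _ _ (SP _)) -/s [phi f](phiE (map (fun t => coset_rep (t * g)%g) s)); last first.
    split.
    + rewrite map_inj_in_uniq // => t t' /rs t1 /rs t2 /coset_rep_eqP.
      by rewrite mulgKA => /coset_rep_eq; rewrite t1 t2.
    + by move=> t /mapP[x _ ->]; exact: coset_rep_id.
    + move=> x fx; apply/mapP; exists (coset_rep (x / g)%g).
        by apply: cs; rewrite ind_actE mulgVK.
      apply: coset_rep_eq; rewrite -{1}(mulgVK g x) mulgKA gpredFC; exact: coset_repP.
  rewrite big_map rep_act_sum; apply: eq_bigr => t _.
  rewrite (term_eq _ _ _ (coset_repP _)) /term rep_actZ -rep_actM ind_actE.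
  by rewrite invgM mulgA mulgV mul1g.
- rewrite (phiE [:: coset_rep 1%g]).
    rewrite big_seq1 (term_eq _ _ _ (coset_repP _)) /term deltaE char_ext1.
    by rewrite scale1r invg1 rep_act1.
  split=> // [t|x]; first by rewrite inE => /eqP->; exact: coset_rep_id.
  rewrite deltaE char_ext_eq0 negbK inE => xH; apply/eqP/coset_rep_eq.
  by rewrite divg1.
Qed.

End Frobenius.

(** * Mackey's criterion and Schur's lemma *)

Section Mackey.
Variables (G : groupType) (K : fieldType).
Implicit Types (H M : subgroup G).

(* The [y] that may support a [chi1]-eigenvector of [H1] in [ind chi2]. *)
Definition linked H1 H2 (chi1 : character K H1) (chi2 : character K H2) (y : G) :=
  (forall h, h \in H1 -> exists2 n, (0 < n)%N & ((h ^+ n) ^ y^-1)%g \in H2) /\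
  (forall k, k \in H1 -> (k ^ y^-1)%g \in H2 ->
     char_ext chi2 (k ^ y^-1)%g = char_ext chi1 k).

(** [f] is nonzero at all $y h^n$, while its support meets finitely many cosets of [H2]. Two of
    these elements thus share a coset, and $y h^{j-i} y^{-1}$ lies in [H2]. *)
Lemma wt_linked H1 H2 (chi1 : character K H1) (chi2 : character K H2)
    (f : ind_rep chi2) y : wt chi1 f -> ival f y != 0 -> linked chi1 chi2 y.
Proof.
move=> cf fy.
have fyh h : h \in H1 -> ival f (y * h)%g = char_ext chi1 h * ival f y.
  by move=> hH; rewrite -ind_actE cf.
split=> [h hH|k kH kyH]; last first.
  apply: (mulIf fy); rewrite -ind_mulL // -fyh // conjgE invgK.
  by rewrite mulgA mulgVK.
have [s sP] := ind_supp f.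
have /choice[g gP] : forall n, exists g, g \in s /\ (y * h ^+ n / g)%g \in H2.
  move=> n; have [|g gs yg] := sP (y * h ^+ n)%g; last by exists g.
  by rewrite fyh ?gpredXn // mulf_neq0 // char_ext_eq0 gpredXn.
have sub : {subset map g (iota 0 (size s).+1) <= s}.
  by move=> _ /mapP[n _ ->]; case: (gP n).
have /(uniqPn 1%g) : ~~ uniq (map g (iota 0 (size s).+1)).
  by apply/negP => /uniq_leq_size/(_ sub); rewrite size_map size_iota ltnn.
case=> i [j []]; rewrite size_map size_iota => ij js.
rewrite !(nth_map 0%N) ?size_iota // ?(ltn_trans ij) // !nth_iota ?(ltn_trans ij) //.
rewrite !add0n => e; exists (j - i)%N; first by rewrite subn_gt0.
have [_ Hi] := gP i; have [_ Hj] := gP j; rewrite -e in Hj.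
have := gpredF Hj Hi; rewrite mulgKA invgM.
by rewrite conjgE invgK expgnFr 1?ltnW // !mulgA.
Qed.

Variables (H : subgroup G) (chi : character K H).
Local Notation I := (ind_rep chi).

(* This says that the representation of [M] induced by [chi], viewed as the
   functions of [I] supported on [M], is irreducible. *)
Definition reaches M := forall W : I -> Prop,
  (forall a u w, W u -> W w -> W (a *: u + w)) ->
  (forall g u, g \in M -> W u -> W (rep_act g u)) ->
  forall f, W f -> f != 0 -> (forall x, ival f x != 0 -> x \in M) -> W (delta chi).

(** A function of [I] supported on [H] is a multiple of [delta chi]. *)
Lemma reaches_self : reaches H.
Proof.
move=> W Wl Wg f Wf f0 fH.
have fE : f = ival f 1%g *: delta chi.
  apply: ind_ext => x; rewrite ind_valZ deltaE.
  have [xH|xH] := boolP (x \in H); first by rewrite -{1}[x]mulg1 ind_mulL // mulrC.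
  rewrite char_ext_out // mulr0; apply/eqP; apply: contraNT xH; exact: fH.
have f1 : ival f 1%g != 0 by apply: contraNneq f0 => f1; rewrite fE f1 scale0r.
have W0 : W 0 by have := Wl (-1) _ _ Wf Wf; rewrite scaleN1r addNr.
by rewrite -[delta chi]addr0 -(scalerK f1 (delta chi)) -fE; exact: Wl.
Qed.

(* Take a nonzero element of [W] whose support meets the fewest cosets of [M],
   and translate it to be nonzero at 1.  By irreducibility over [M] its
   restriction to [M] may be taken to be [delta]; then [h w - chi(h) w] has a
   smaller support for [h] in [H], so [w] is an eigenvector of [H], supported
   on linked elements, that is on [M]. *)
Lemma reaches_normal M M' : {subset H <= M} -> {subset M <= M'} ->
  (forall x m, x \in M' -> m \in M -> (m ^ x)%g \in M) ->
  (forall y, linked chi chi y -> y \in M) -> reaches M -> reaches M'.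
Proof.
move=> HM MM' nM lM rM W Wl Wg f0 Wf0 f0N f0M'.
pose P n := exists (f : I) (s : seq G), [/\ W f, f != 0, size s = n,
  {subset s <= M'} & forall x, ival f x != 0 -> exists2 g, g \in s & (x / g)%g \in M].
have /ex_minnP[n /asboolP[f [s [Wf fN sz sM' fs]]] nmin] : exists n, `[< P n >].
  have [s0 s0P] := ind_supp f0; exists (size [seq g <- s0 | g \in M']); apply/asboolP.
  exists f0, [seq g <- s0 | g \in M']; split=> // [g|x fx].
    by rewrite mem_filter => /andP[].
  have [g gs xg] := s0P x fx; exists g; last exact: HM.
  by rewrite mem_filter gs andbT; have := MM' _ (HM _ xg); rewrite gpredFl // f0M'.
have [x0 fx0] := ind_neq0 fN.
have x0M' : x0 \in M'.
  by have [g /sM' gM' /MM' xg] := fs _ fx0; rewrite -(mulgVK g x0) gpredM.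
pose s1 := [seq (g / x0)%g | g <- s].
have s1M' : {subset s1 <= M'} by move=> _ /mapP[g /sM' gM' ->]; rewrite gpredF.
(* [N1] collects the elements of [W] supported on the translated cosets; it is stable under [M]
   because [M] is normal in [M']. The hypothesis on [M] applies to [W1], their restrictions to
   [M]. *)
pose N1 (w : I) := W w /\ forall x, ival w x != 0 -> exists2 g, g \in s1 & (x / g)%g \in M.
pose W1 (u : I) := exists2 w, N1 w &
  forall x, ival u x = if x \in M then ival w x else 0.
have N1f : N1 (rep_act x0 f).
  split; first exact: Wg.
  move=> x; rewrite ind_actE => /fs[g gs xg]; exists (g / x0)%g; first exact: map_f.
  by rewrite invgF mulgA.
have N1l a u w : N1 u -> N1 w -> N1 (a *: u + w).
  move=> [Wu us] [Ww ws]; split; first exact: Wl.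
  move=> x; have [ux|ux] := eqVneq (ival u x) 0; last by move=> _; exact: us.
  by rewrite ind_valD ind_valZ ux mulr0 add0r; exact: ws.
have N1g g u : g \in M -> N1 u -> N1 (rep_act g u).
  move=> gM [Wu us]; split; first by apply: Wg => //; exact: MM'.
  move=> x; rewrite ind_actE => /us[t ts xt]; exists t => //.
  have -> : (x / t = (x * g / t) * (g^-1 ^ t^-1))%g.
    by rewrite conjgE invgK !mulgA mulgVK mulgK.
  by rewrite gpredM // nM ?gpredV // s1M'.
have [u uE] : exists u : I, forall x, ival u x =
    if x \in M then ival (rep_act x0 f) x else 0.
  apply: ind_mk => [h x hH|].
    have hM := HM _ hH; rewrite gpredMl // ind_mulL //.
    by case: ifP; rewrite ?mulr0.
  have [t tP] := ind_supp (rep_act x0 f); exists t => x.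
  by case: ifP => _ => [/tP|/eqP].
have W1d : W1 (delta chi).
  apply: (rM W1 _ _ u).
  - move=> a p q [p' Np pE] [q' Nq qE]; exists (a *: p' + q'); first exact: N1l.
    move=> x; rewrite !ind_valD !ind_valZ pE qE.
    by case: ifP => // _; rewrite mulr0 addr0.
  - move=> g p gM [p' Np pE]; exists (rep_act g p'); first exact: N1g.
    by move=> x; rewrite !ind_actE pE gpredMr.
  - by exists (rep_act x0 f).
  - apply: contraNneq fx0 => /(congr1 (fun f : I => ival f 1%g)).
    by rewrite uE gpred1 ind_actE mul1g => ->.
  - by move=> x; rewrite uE; case: ifP => // _ /eqP.
case: W1d => w Nw wE.
have cw : wt chi w.
  move=> h hH; apply/eqP; rewrite -subr_eq0; apply/negPn/negP => vN.
  set v := _ - _ in vN.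
  have [Wv vs] : N1 v.
    by rewrite /v addrC -scaleNr; apply: N1l => //; apply: N1g => //; exact: HM.
  have v0 : forall x, x \in M -> ival v x = 0.
    move=> x xM; have dw y : y \in M -> ival w y = ival (delta chi) y.
      by move=> yM; rewrite wE yM.
    have hM := HM _ hH.
    rewrite /v -scaleNr ind_valD ind_valZ ind_actE !dw // ?gpredM //.
    by rewrite -ind_actE delta_wt // ind_valZ mulNr subrr.
  pose s2 := [seq g <- s1 | g \notin M].
  have : (n <= size s2)%N.
    apply: nmin; apply/asboolP; exists v, s2; split=> //.
      by move=> g; rewrite mem_filter => /andP[_]; exact: s1M'.
    move=> x vx; have [g gs xg] := vs x vx; exists g => //; rewrite mem_filter gs andbT.
    by apply: contra vx => gM; apply/eqP/v0; rewrite -(mulgVK g x) gpredM.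
  (* The translate of [f] is nonzero at 1, so some representative lies in [M] and [s2] is strictly
     shorter than [s], against minimality. *)
  have [_ /(_ 1%g)] := N1f; rewrite ind_actE mul1g => /(_ fx0)[g gs].
  rewrite div1g gpredV => gM; rewrite leqNgt size_filter -sz -(size_map (fun g => g / x0)%g s).
  rewrite -/s1 -(count_predC (mem M) s1) -[X in (X < _)%N]add0n ltn_add2r.
  by rewrite -has_count; case/negP; apply/hasP; exists g.
have -> : delta chi = w; last by case: Nw.
apply: ind_ext => x; rewrite wE; case: ifPn => // xM.
by apply/eqP; rewrite eq_sym; apply: contraNT xM => wx; exact/lM/(wt_linked cw).
Qed.

Lemma reaches_irreducible M : (forall x, x \in M) -> reaches M -> irreducible I.
Proof.
move=> MT rM; split; first by exists (delta chi); exact: delta_neq0.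
move=> W [W0 Wl] Wg; have [|] := pselect (exists2 f, f \in W & f != 0).
  move=> [f fW f0]; right => u; rewrite inE.
  apply: (ind_generated (W := fun u => u \in W)) => [a ? ?|g ?|]; [exact: Wl|exact: Wg|].
  by apply: (rM (fun u => u \in W) _ _ _ fW f0) => [a ? ?|g ? _|]; [exact: Wl|exact: Wg|].
move=> nf; left => u; rewrite inE; apply/idP/eqP => [uW|->//].
by apply/eqP/negPn/negP => u0; apply: nf; exists u.
Qed.

End Mackey.

(** * Conjugate pairs induce isomorphic representations *)

Section Conjugation.
Variables (G : groupType) (K : fieldType) (H : subgroup G) (chi : character K H).

(** Frobenius reciprocity, applied to the translates of the two generators by [g] and its inverse,
    gives mutually inverse intertwiners. *)
Lemma conj_character g : exists (H' : subgroup G) (chi' : character K H'),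
  [/\ H' =i conj_set g H, forall x, x \in H' -> char_ext chi' x = char_ext chi (x ^ g)%g
    & rep_iso (ind_rep chi) (ind_rep chi')].
Proof.
have [|x y|x|H' H'P] := @mk_subgroup G (fun x => (x ^ g)%g \in H).
- by rewrite conj1g gpred1.
- by rewrite conjMg => *; rewrite gpredM.
- by rewrite conjVg gpredV.
have H'E : H' =i conj_set g H by move=> x; rewrite conj_setE; apply/idP/idP => /H'P.
have [x /H'P xH|x y /H'P xH /H'P yH|chi' cE] :=
    @mk_character _ _ H' (fun x => char_ext chi (x ^ g)%g).
- by rewrite char_ext_eq0 xH.
- by rewrite conjMg char_extM.
exists H', chi'; split=> //.
have w1 : wt chi' (rep_act g (delta chi)).
  move=> h hH'; have hH := (H'P h).1 hH'.
  by rewrite rep_act_swap delta_wt // rep_actZ cE.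
have w2 : wt chi (rep_act g^-1%g (delta chi')).
  move=> h hH; have hH' : (h ^ g^-1)%g \in H' by apply/H'P; rewrite conjgKV.
  by rewrite rep_act_swap delta_wt // rep_actZ cE // conjgKV.
have [phi tw1 e1] := frobenius w2; have [psi tw2 e2] := frobenius w1.
exists phi => //; exists psi.
- apply: (@ind_intertwiners_eq _ _ _ _ _ (psi \o phi) id) => //; first exact: intertwiners_comp.
  by rewrite /= e1 tw2.2 e2 rep_actK.
- apply: (@ind_intertwiners_eq _ _ _ _ _ (phi \o psi) id) => //; first exact: intertwiners_comp.
  by rewrite /= e2 tw1.2 e1 rep_actVK.
Qed.

End Conjugation.

(** * Schur's lemma in countable dimension *)

Section Schur.
Variables (G : groupType) (K : closedFieldType).
(** Uncountability in pigeonhole form: some fibre of [f] is infinite. *)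
Hypothesis K_uncountable : forall f : K -> nat,
  exists k, forall n, exists s : seq K, [/\ uniq s, size s = n & forall x, x \in s -> f x = k].
Variables (code : G -> nat) (decode : nat -> G).
Hypothesis codeK : cancel code decode.
Variables (H : subgroup G) (chi : character K H).
Local Notation I := (ind_rep chi).
Hypothesis irrI : irreducible I.

(* Otherwise all [phi - a] are invertible, and finitely many vectors
   [(phi - a)^-1 delta] are linearly dependent only if a nonzero polynomial in
   [phi] kills [delta]; uncountably many of them cannot be independent in a
   space of countable dimension. *)
Lemma schur_ind (phi : I -> I) : intertwiners phi ->
  exists a, phi (delta chi) = a *: delta chi.
Proof.
move=> tw; apply: contrapT => /forallNP na.
have inj a w : w != 0 -> phi w <> a *: w.
  move=> w0 pw; apply: (na a).
  apply: (irreducible_all (W := fun w => phi w = a *: w) irrI _ _ pw w0) => [b u v pu pv|g u pu].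
    by rewrite tw.1 pu pv scalerDr !scalerA mulrC.
  by rewrite tw.2 pu rep_actZ.
have /choice[u uP] : forall a, exists u, phi u - a *: u = delta chi.
  move=> a; pose d := phi (delta chi) - a *: delta chi.
  have d0 : d != 0 by rewrite subr_eq0; apply/eqP/na.
  apply: (irreducible_all (W := fun w => exists u, phi u - a *: u = w) irrI _ _ _ d0).
  - move=> b _ _ [x <-] [y <-]; exists (b *: x + y).
    rewrite tw.1 scalerBr scalerDr !scalerA [a * b]mulrC -!scaleNr.
    by rewrite opprD addrACA !scaleNr.
  - by move=> g _ [x <-]; exists (rep_act g x); rewrite tw.2 rep_actD -!scaleNr rep_actZ.
  - by exists (delta chi).
(* [N a] bounds the codes of representatives of the cosets that support [u a]. *)
have /choice[N NP] : forall a, exists N, forall x, ival (u a) x != 0 ->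
    exists2 g, (code g < N)%N & (x / g)%g \in H.
  move=> a; have [s sP] := ind_supp (u a); exists (\max_(g <- s) code g).+1 => x /sP[g gs xg].
  by exists g => //; rewrite ltnS; apply: leq_bigmax_seq.
have [k kP] := K_uncountable N; have [s [us sz sN]] := kP k.+1.
pose l (i : 'I_k.+1) := s`_i.
have lN i : N (l i) = k by apply/sN/mem_nth; rewrite sz.
(* The [k + 1] vectors [u (l i)] are determined by their values at the [k] points with codes below
   [k], hence are dependent. *)
have [c [[i0 ci0] cP]] := @mx_row_dep K k.+1 k
  (\matrix_(i, j) ival (u (l i)) (decode j)) (ltnSn k).
have cu : \sum_i c i *: u (l i) = 0.
  apply: ind_ext => x; rewrite ind_val0; apply/eqP/negPn/negP => nx.
  have [i ux] : exists i, ival (u (l i)) x != 0.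
    apply: contrapT => /forallNP n; case/negP: nx; rewrite ind_val_sum big1 // => i _.
    by rewrite ind_valZ; have /negP/negPn/eqP-> := n i; rewrite mulr0.
  have [g gN xg] := NP _ _ ux; rewrite lN in gN.
  case/negP: nx; rewrite -{1}(mulgVK g x) ind_mulL // mulf_eq0; apply/orP; right.
  have := cP (Ordinal gN); under eq_bigr do rewrite mxE /= codeK.
  by rewrite ind_val_sum => /eqP.
(* [q] is the numerator of $\sum_i c_i/(X - l_i)$ over the common denominator; it is nonzero at
   $l_{i_0}$, where a single term survives. *)
pose Q (i : 'I_k.+1) := \prod_(j | j != i) ('X - (l j)%:P).
pose q := \sum_i c i *: Q i.
have linphi := tw.1.
have q0 : q != 0.
  apply/negP => /eqP/(congr1 (horner^~ (l i0))); rewrite horner0 horner_sum.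
  rewrite (bigD1 i0) //= big1 ?addr0 => [|i ii0].
    apply/eqP; rewrite hornerZ mulf_neq0 // horner_prod; apply/prodf_neq0 => j ji.
    rewrite hornerXsubC subr_eq0; apply: contraNneq ji => /eqP.
    by rewrite nth_uniq ?sz // => /eqP/val_inj->.
  rewrite hornerZ horner_prod (bigD1 i0) 1?eq_sym //= hornerXsubC subrr mul0r.
  by rewrite mulr0.
have qd : pact phi q (delta chi) = 0.
  pose T := \prod_j ('X - (l j)%:P).
  have QE i : pact phi (Q i) (delta chi) = pact phi T (u (l i)).
    rewrite /T (bigD1 i) //= -/(Q i) mulrC pactMXsubC // -(uP (l i)) addrC -scaleNr.
    by rewrite pact_linear // pact_T // scaleNr addrC.
  rewrite pact_sum; under eq_bigr do rewrite pactZ QE.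
  have tD := pact_linear linphi T.
  have TD v w : pact phi T (v + w) = pact phi T v + pact phi T w.
    by have := tD 1 v w; rewrite !scale1r.
  have T0 : pact phi T 0 = 0 by apply: (addrI (pact phi T 0)); rewrite -TD !addr0.
  have TZ a v : pact phi T (a *: v) = a *: pact phi T v.
    by have := tD a v 0; rewrite T0 !addr0.
  under eq_bigr do rewrite -TZ.
  by rewrite -(big_morph _ TD T0) cu.
have [r qr] := closed_field_poly_normal q.
move: qd; rewrite qr pactZ => /eqP; rewrite scaler_eq0 lead_coef_eq0 (negPf q0) /=.
move=> /eqP /(eigen_of_prod linphi (E := fun=> True))[]//; first exact: delta_neq0.
by move=> w [a [_ w0 _ /(inj _ _ w0)]].
Qed.

Lemma ind_wt_delta (w : I) : wt chi w -> exists a, w = a *: delta chi.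
Proof. by move=> /frobenius[phi tw <-]; exact: schur_ind. Qed.

(** The translate of [delta] by [y] is again a weight vector, so a multiple of [delta]; but it is
    supported on $Hy^{-1}$. *)
Lemma ind_normalizer y : (forall h, h \in H -> (h ^ y)%g \in H /\
  char_ext chi (h ^ y)%g = char_ext chi h) -> y \in H.
Proof.
move=> yN; have [|a ad] := @ind_wt_delta (rep_act y (delta chi)).
  by move=> h /yN[hy cy]; rewrite rep_act_swap delta_wt // cy rep_actZ.
have /(congr1 (fun f : I => ival f y^-1%g)) := ad.
rewrite ind_actE ind_valZ !deltaE mulVg char_ext1.
move=> e; rewrite -gpredV; apply: contraPT (esym e) => yH; rewrite char_ext_out //.
by rewrite mulr0 => /esym/eqP; rewrite oner_eq0.
Qed.

(** The pair [(H, chi)] itself works: its weight space is the line through [delta]. *)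
Lemma ind_finite_weight : finite_weight I.
Proof.
pose phi (z : char_rep chi) : res_rep H I := (z : K) *: delta chi.
have phi_tw : intertwiners phi.
  split=> [a u v|g v]; first by rewrite /phi scalerDl scalerA.
  have := delta_wt chi (valP g); rewrite char_ext_val /= => e.
  apply: (etrans (y := (v : K) *: (chi g *: delta chi))).
    by rewrite scalerA mulrC.
  by rewrite -e; symmetry; exact: rep_actZ.
exists H, chi; split.
  by exists phi => //; exists 1; rewrite /phi scale1r; exact: delta_neq0.
exists 1%N, (fun=> phi); split=> // psi tw.
have [|a psi1] := @ind_wt_delta (psi (1 : K^o)).
  move=> _ /subg_val[h ->]; rewrite char_ext_val.
  exact: etrans (esym (tw.2 h (1 : K^o))) (intertwinersZ tw (chi h) (1 : K^o)).
exists (fun=> a); rewrite big_ord1; apply/funext => z.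
apply: (etrans (y := psi (z *: (1 : K^o)))).
  by congr psi; rewrite /GRing.scale /= mulr1.
rewrite (intertwinersZ tw) psi1.
apply: (etrans (y := a *: ((z : K) *: delta chi))) => //.
by rewrite !scalerA mulrC.
Qed.

End Schur.

(** * Coordinates on the unitriangular group *)

Section UT4.
Local Notation G := UT4.

Let o0 : 'I_4 := @Ordinal 4 0 isT.
Let o1 : 'I_4 := @Ordinal 4 1 isT.
Let o2 : 'I_4 := @Ordinal 4 2 isT.
Let o3 : 'I_4 := @Ordinal 4 3 isT.

Definition c12 (g : G) : int := val g o0 o1.
Definition c23 (g : G) : int := val g o1 o2.
Definition c34 (g : G) : int := val g o2 o3.
Definition c13 (g : G) : int := val g o0 o2.
Definition c24 (g : G) : int := val g o1 o3.
Definition c14 (g : G) : int := val g o0 o3.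

Lemma ord4P (P : 'I_4 -> Prop) : P o0 -> P o1 -> P o2 -> P o3 -> forall i, P i.
Proof.
move=> p0 p1 p2 p3 [[|[|[|[|n]]]] ni] //.
- by rewrite (_ : Ordinal ni = o0) //; exact: val_inj.
- by rewrite (_ : Ordinal ni = o1) //; exact: val_inj.
- by rewrite (_ : Ordinal ni = o2) //; exact: val_inj.
- by rewrite (_ : Ordinal ni = o3) //; exact: val_inj.
Qed.

Lemma utL (g : G) (i j : 'I_4) : (j <= i)%N -> val g i j = (i == j)%:R.
Proof. by move=> ji; have /unitriP -> := valP g. Qed.

Lemma ut_ext (g h : G) : c12 g = c12 h -> c23 g = c23 h -> c34 g = c34 h ->
  c13 g = c13 h -> c24 g = c24 h -> c14 g = c14 h -> g = h.
Proof.
move=> h12 h23 h34 h13 h24 h14; apply/val_inj/matrixP.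
by elim/ord4P; elim/ord4P => //; rewrite !utL.
Qed.

Lemma ut_mulE (g h : G) i j :
  val (g * h)%g i j = \sum_(k < 4) val g i k * val h k j.
Proof. by rewrite [LHS]mxE. Qed.

Ltac ut_entry := rewrite /c12 /c23 /c34 /c13 /c24 /c14 ut_mulE !big_ord_recl big_ord0;
  rewrite -/o0 (_ : lift ord0 ord0 = o1); [|exact: val_inj];
  rewrite (_ : lift ord0 (lift ord0 ord0) = o2); [|exact: val_inj];
  rewrite (_ : lift ord0 (lift ord0 (lift ord0 ord0)) = o3); [|exact: val_inj];
  rewrite (_ : ord0 = o0); [|exact: val_inj];
  rewrite ?(@utL _ o0 o0) ?(@utL _ o1 o1) ?(@utL _ o2 o2) ?(@utL _ o3 o3)
    ?(@utL _ o1 o0) ?(@utL _ o2 o0) ?(@utL _ o3 o0) ?(@utL _ o2 o1)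
    ?(@utL _ o3 o1) ?(@utL _ o3 o2) //=; ring.

Lemma c12M g h : c12 (g * h)%g = c12 g + c12 h. Proof. ut_entry. Qed.
Lemma c23M g h : c23 (g * h)%g = c23 g + c23 h. Proof. ut_entry. Qed.
Lemma c34M g h : c34 (g * h)%g = c34 g + c34 h. Proof. ut_entry. Qed.
Lemma c13M g h : c13 (g * h)%g = c13 g + c12 g * c23 h + c13 h. Proof. ut_entry. Qed.
Lemma c24M g h : c24 (g * h)%g = c24 g + c23 g * c34 h + c24 h. Proof. ut_entry. Qed.
Lemma c14M g h :
  c14 (g * h)%g = c14 g + c13 g * c34 h + c12 g * c24 h + c14 h. Proof. ut_entry. Qed.

Lemma ut1E : [/\ c12 1%g = 0, c23 1%g = 0 & c34 1%g = 0] /\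
  [/\ c13 1%g = 0, c24 1%g = 0 & c14 1%g = 0].
Proof. by rewrite /c12 /c23 /c34 /c13 /c24 /c14 /= !mxE. Qed.

Lemma c12_1 : c12 1%g = 0. Proof. by case: ut1E => [[]]. Qed.
Lemma c23_1 : c23 1%g = 0. Proof. by case: ut1E => [[]]. Qed.
Lemma c34_1 : c34 1%g = 0. Proof. by case: ut1E => [[]]. Qed.
Lemma c13_1 : c13 1%g = 0. Proof. by case: ut1E => [_ []]. Qed.
Lemma c24_1 : c24 1%g = 0. Proof. by case: ut1E => [_ []]. Qed.
Lemma c14_1 : c14 1%g = 0. Proof. by case: ut1E => [_ []]. Qed.

Lemma c12V g : c12 g^-1%g = - c12 g.
Proof. have := c12M g g^-1%g; rewrite mulgV c12_1; lia. Qed.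
Lemma c23V g : c23 g^-1%g = - c23 g.
Proof. have := c23M g g^-1%g; rewrite mulgV c23_1; lia. Qed.
Lemma c34V g : c34 g^-1%g = - c34 g.
Proof. have := c34M g g^-1%g; rewrite mulgV c34_1; lia. Qed.
Lemma c13V g : c13 g^-1%g = c12 g * c23 g - c13 g.
Proof. have := c13M g g^-1%g; rewrite mulgV c13_1 c23V; lia. Qed.
Lemma c24V g : c24 g^-1%g = c23 g * c34 g - c24 g.
Proof. have := c24M g g^-1%g; rewrite mulgV c24_1 c34V; lia. Qed.
Lemma c14V g :
  c14 g^-1%g = c12 g * c24 g + c13 g * c34 g - c12 g * c23 g * c34 g - c14 g.
Proof. have := c14M g g^-1%g; rewrite mulgV c14_1 c34V c24V; lia. Qed.

Definition utE := (c12M, c23M, c34M, c13M, c24M, c14M,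
  (c12V, c23V, c34V, c13V, c24V, c14V), (c12_1, c23_1, c34_1, c13_1, c24_1, c14_1)).

Definition ut_mx (a b c d e f : int) : 'M[int]_4 :=
  \matrix_(i, j) nth 0 (nth [::] [:: [:: 1; a; d; f]; [:: 0; 1; b; e];
    [:: 0; 0; 1; c]; [:: 0; 0; 0; 1]] i) j.

Lemma ut_mx_unitri a b c d e f : ut_mx a b c d e f \in @unitri 3.
Proof. by apply/unitriP; elim/ord4P; elim/ord4P => //= _; rewrite mxE. Qed.

Definition ut_mk a b c d e f : G :=
  exist (fun A : 'M[int]_4 => A \in @unitri 3) _ (ut_mx_unitri a b c d e f).

Lemma c12_mk a b c d e f : c12 (ut_mk a b c d e f) = a. Proof. by rewrite /c12 mxE. Qed.
Lemma c23_mk a b c d e f : c23 (ut_mk a b c d e f) = b. Proof. by rewrite /c23 mxE. Qed.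
Lemma c34_mk a b c d e f : c34 (ut_mk a b c d e f) = c. Proof. by rewrite /c34 mxE. Qed.
Lemma c13_mk a b c d e f : c13 (ut_mk a b c d e f) = d. Proof. by rewrite /c13 mxE. Qed.
Lemma c24_mk a b c d e f : c24 (ut_mk a b c d e f) = e. Proof. by rewrite /c24 mxE. Qed.
Lemma c14_mk a b c d e f : c14 (ut_mk a b c d e f) = f. Proof. by rewrite /c14 mxE. Qed.

Definition ut_mkE := (c12_mk, c23_mk, c34_mk, c13_mk, c24_mk, c14_mk).

End UT4.

(** * Subnormality and enlargement of weights by second-central elements *)

Section Chain.
Variables (K : fieldType) (H : subgroup UT4) (chi : character K H).

(** [M1] is [H] times the centre, [M2] is [H] times $[G,G]$ and [M3] is the whole group. Each group
    of the chain [H], [M1], [M2], [M3] is normal in the next, so [reaches_normal] climbs it. *)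
Lemma ut_irreducible :
  (forall y, linked chi chi y -> y \in H) -> irreducible (ind_rep chi).
Proof.
move=> lH.
pose P1 g := exists2 h, h \in H & [/\ c12 g = c12 h, c23 g = c23 h, c34 g = c34 h,
  c13 g = c13 h & c24 g = c24 h].
pose P2 g := exists2 h, h \in H & [/\ c12 g = c12 h, c23 g = c23 h & c34 g = c34 h].
have [|x y [h hH [? ? ? ? ?]] [k kH [? ? ? ? ?]]|x [h hH [? ? ? ? ?]]|M1 M1P] :=
    @mk_subgroup _ P1.
- by exists 1%g; rewrite ?gpred1.
- by exists (h * k)%g; [rewrite gpredM | split; rewrite !utE; congruence].
- by exists h^-1%g; [rewrite gpredV | split; rewrite !utE; congruence].
have [|x y [h hH [? ? ?]] [k kH [? ? ?]]|x [h hH [? ? ?]]|M2 M2P] :=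
    @mk_subgroup _ P2.
- by exists 1%g; rewrite ?gpred1.
- by exists (h * k)%g; [rewrite gpredM | split; rewrite !utE; congruence].
- by exists h^-1%g; [rewrite gpredV | split; rewrite !utE; congruence].
have [|||M3 M3P] := @mk_subgroup UT4 (fun=> True) => //.
have HM1 : {subset H <= M1} by move=> h hH; apply/M1P; exists h.
have M12 : {subset M1 <= M2} by move=> g /M1P[h hH [? ? ? ? ?]]; apply/M2P; exists h.
have HM2 : {subset H <= M2} by move=> h /HM1/M12.
have M23 : {subset M2 <= M3} by move=> g _; exact/M3P.
have HM3 : {subset H <= M3} by move=> h /HM2/M23.
have r1 : reaches chi M1.
  apply: (reaches_normal (M := H) _ HM1 _ lH (@reaches_self _ _ _ chi)) => //.
  move=> x m /M1P[k kH [e1 e2 e3 e4 e5]] mH.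
  rewrite (_ : (m ^ x)%g = (m ^ k)%g) ?gpredJ //.
  by apply: ut_ext; rewrite !conjgE !utE ?e1 ?e2 ?e3 ?e4 ?e5; ring.
have r2 : reaches chi M2.
  apply: (reaches_normal HM1 M12 _ _ r1) => [x m /M2P[k kH [e1 e2 e3]] /M1P|y /lH/HM1 //].
  move=> [h hH [f1 f2 f3 f4 f5]]; apply/M1P; exists (h ^ k)%g; first by rewrite gpredJ.
  by split; rewrite !conjgE !utE ?e1 ?e2 ?e3 ?f1 ?f2 ?f3 ?f4 ?f5; ring.
have r3 : reaches chi M3.
  apply: (reaches_normal HM2 M23 _ _ r2) => [x m _ /M2P|y /lH/HM2 //].
  move=> [h hH [f1 f2 f3]]; apply/M2P; exists h => //.
  by split; rewrite !conjgE !utE ?f1 ?f2 ?f3; ring.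
by apply: (reaches_irreducible _ r3) => x; exact/M3P.
Qed.

End Chain.

(** The second centre, equal to $[G,G]$ by [gamma1_UT4]. *)
Definition in_Z2 (x : UT4) := [/\ c12 x = 0, c23 x = 0 & c34 x = 0].

(* The commutator of [x] in [in_Z2] with [h] is [zc (ell x h)]. *)
Definition ell (x h : UT4) : int := c13 x * c34 h - c12 h * c24 x.

Definition zc (k : int) : UT4 := ut_mk 0 0 0 0 0 k.

Lemma zc_comm k g : (zc k * g = g * zc k)%g.
Proof. by apply: ut_ext; rewrite !utE !ut_mkE; ring. Qed.

Lemma zcD k l : zc (k + l) = (zc k * zc l)%g.
Proof. by apply: ut_ext; rewrite !utE !ut_mkE; ring. Qed.

Lemma ell_comm x h : in_Z2 x -> (x * h = h * x * zc (ell x h))%g.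
Proof.
by move=> [x1 x2 x3]; apply: ut_ext; rewrite /ell !utE !ut_mkE ?x1 ?x2 ?x3; ring.
Qed.

Lemma ellM x g h : ell x (g * h)%g = ell x g + ell x h.
Proof. by rewrite /ell !utE; ring. Qed.

Lemma ell1 x : ell x 1%g = 0.
Proof. by rewrite /ell !utE; ring. Qed.

Lemma ut_expE (g : UT4) n : [/\ c12 (g ^+ n)%g = c12 g *+ n,
  c23 (g ^+ n)%g = c23 g *+ n & c34 (g ^+ n)%g = c34 g *+ n].
Proof.
elim: n => [|n [e1 e2 e3]]; first by rewrite expg0 !utE !mulr0n.
by rewrite expgS !utE e1 e2 e3 !mulrS.
Qed.

Lemma Z2_exp x n : in_Z2 x -> [/\ in_Z2 (x ^+ n)%g, c13 (x ^+ n)%g = c13 x *+ n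
  & c24 (x ^+ n)%g = c24 x *+ n].
Proof.
move=> [x1 x2 x3]; have [e1 e2 e3] := ut_expE x n.
split; first by rewrite /in_Z2 e1 e2 e3 x1 x2 x3 !mul0rn.
- elim: n {e1 e2 e3} => [|n IH]; first by rewrite expg0 !utE.
  by rewrite expgS !utE IH x1 mulrS; ring.
- elim: n {e1 e2 e3} => [|n IH]; first by rewrite expg0 !utE.
  by rewrite expgS !utE IH x2 mulrS; ring.
Qed.

(** Modulo the centre [u] is central, so $(uh)^n h^{-n}$ is $u^n$ there. *)
Lemma Z2_mulX u h n : in_Z2 u ->
  [/\ in_Z2 ((u * h) ^+ n * h ^- n)%g, c13 ((u * h) ^+ n * h ^- n)%g = c13 u *+ n
    & c24 ((u * h) ^+ n * h ^- n)%g = c24 u *+ n].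
Proof.
move=> [u1 u2 u3].
have E : [/\ c13 ((u * h) ^+ n)%g = c13 u *+ n + c13 (h ^+ n)%g
           & c24 ((u * h) ^+ n)%g = c24 u *+ n + c24 (h ^+ n)%g].
  elim: n => [|n [IH1 IH2]]; first by rewrite !expg0 !utE.
  have [a1 a2 a3] := ut_expE (u * h)%g n; have [b1 b2 b3] := ut_expE h n.
  rewrite !expgS !utE IH1 IH2 a2 a3 b2 b3 !utE u1 u2 u3 !mulrS.
  by split; ring.
have [a1 a2 a3] := ut_expE (u * h)%g n; have [b1 b2 b3] := ut_expE h n.
case: E => E1 E2; rewrite /in_Z2 !utE E1 E2 a1 a2 a3 b1 b2 b3 !utE u1 u2 u3 !add0r.
by split; [split|..]; ring.
Qed.

Lemma conj_Z2 y h : exists2 u, in_Z2 u & (h ^ y = u * h)%g.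
Proof.
exists (h ^ y * h^-1)%g; last by rewrite mulgVK.
by split; rewrite !conjgE !utE; ring.
Qed.

(** Independence of eigenvectors: the eigenvalues [b * m] are distinct as [m] is nonzero. *)
Lemma sum_eigen0 (K : fieldType) (V : lmodType K) (T : V -> V) (m : K) (s : seq K)
    (F : K -> V) : linear T -> m != 0 -> uniq s ->
  (forall b, b \in s -> T (F b) = (b * m) *: F b) ->
  \sum_(b <- s) F b = 0 -> forall b, b \in s -> F b = 0.
Proof.
move=> linT m0; have TD u v : T (u + v) = T u + T v.
  by have := linT 1 u v; rewrite !scale1r.
have T0 : T 0 = 0 by apply: (addrI (T 0)); rewrite -TD !addr0.
have TZ a u : T (a *: u) = a *: T u by have := linT a u 0; rewrite T0 !addr0.
elim: s F => [//|c s IH] F /= /andP[cs us] TF; rewrite big_cons => S0.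
have Ts b : b \in s -> F b = 0.
  move=> bs; have : ((b - c) * m) *: F b = 0.
    apply: (IH (fun b => ((b - c) * m) *: F b)) => // [d ds|].
      by rewrite TZ TF ?inE ?ds ?orbT // !scalerA mulrC.
    have := congr1 T S0; rewrite TD T0 (big_morph T TD T0) TF ?inE ?eqxx // => e.
    have := congr1 (fun v => (c * m) *: v) S0; rewrite scalerDr scaler0 => e'.
    have := congr2 (fun u v => u - v) e e'; rewrite subrr opprD addrACA subrr add0r.
    move=> e2; apply: etrans e2; rewrite scaler_sumr -sumrB !big_seq; apply: eq_bigr => d ds.
    by rewrite TF ?inE ?ds ?orbT // mulrBl scalerBl.
  move/eqP; rewrite scaler_eq0 mulf_eq0 (negPf m0) orbF subr_eq0.
  by case/orP => [/eqP bc|/eqP//]; rewrite -bc bs in cs.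
move=> b; rewrite inE => /predU1P[->|/Ts//].
by move: S0; rewrite big_seq big1 ?addr0 // => d /Ts.
Qed.

(** * Exchange of weights when the central character has finite order *)

Section Swap.
Variables (K : closedFieldType) (V : representation UT4 K) (zeta : int -> K).
Hypothesis zetaP : forall k (v : V), rep_act (zc k) v = zeta k *: v.
Hypothesis zetaD : forall k l, zeta (k + l) = zeta k * zeta l.
Variable n : nat.
Hypotheses (n0 : (0 < n)%N) (zetan : zeta n%:Z = 1).

Let zeta0 : zeta 0 = 1.
Proof.
have h : zeta n%:Z * zeta 0 = zeta n%:Z by rewrite -zetaD addr0.
by rewrite zetan mul1r in h.
Qed.

Let zetaMn k m : zeta (k *+ m) = zeta k ^+ m.
Proof. by elim: m => [|m IH]; rewrite ?mulr0n ?zeta0 // mulrS zetaD IH exprS. Qed.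

Let zeta_expn k : zeta k ^+ n = 1.
Proof.
have posn (m : nat) : zeta m%:Z ^+ n = 1.
  have e : m%:Z *+ n = n%:Z *+ m by rewrite -(natz m) -(natz n) -!mulrnA mulnC.
  by rewrite -zetaMn e zetaMn zetan expr1n.
case: k => // m; rewrite NegzE; have := posn m.+1; set k := Posz _.
have : zeta k * zeta (- k) = 1 by rewrite -zetaD subrr.
by move=> /(congr1 (fun z => z ^+ n)); rewrite exprMn expr1n => + e; rewrite e mul1r.
Qed.

(* Trade the part of [H] not commuting with [x] for [x] itself.  The new weight
   space embeds in the old one by averaging over the finitely many cosets of
   the kernel of [h |-> zeta (ell x h)] on [H]: the averaged terms are
   eigenvectors of [x] for distinct eigenvalues. *)
Lemma swap_weight (H : subgroup UT4) (chi : character K H) (v : V) d x :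
  in_Z2 x -> wt chi v -> v != 0 -> dim_le (wt (V := V) chi) d ->
  exists (H' : subgroup UT4) (chi' : character K H'),
    [/\ x \in H', forall h, h \in H -> ell x h = 0 -> h \in H',
        exists2 u : V, wt chi' u & u != 0 & dim_le (wt (V := V) chi') d].
Proof.
move=> xZ cv v0 Ed; pose beta h := zeta (ell x h).
have betaM g h : beta (g * h)%g = beta g * beta h by rewrite /beta ellM zetaD.
have beta1 : beta 1%g = 1 by rewrite /beta ell1.
have betaV h : beta h * beta h^-1%g = 1 by rewrite -betaM mulgV.
have xh h (w : V) : rep_act x (rep_act h w) = beta h *: rep_act h (rep_act x w).
  by rewrite -rep_actM ell_comm // rep_actM zetaP rep_actZ rep_actM.
have linx := @rep_linear _ _ V x.
have itx m (w : V) : iter m (rep_act x) w = rep_act (x ^+ m)%g w.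
  by elim: m => [|m IH] /=; rewrite ?rep_act1 // IH -rep_actM -expgS.
(* Since [zeta] has values of order dividing [n], $x^n$ commutes with [H] on [V]. *)
have xnE (w : V) : wt chi w -> wt chi (rep_act (x ^+ n)%g w).
  move=> cw h hH; have [xnZ x1 x2] := Z2_exp n xZ.
  have := cw h hH => ch; have := rep_actM (x ^+ n)%g h w; rewrite ell_comm //.
  have -> : ell (x ^+ n)%g h = ell x h *+ n.
    by rewrite /ell x1 x2 mulrnAl mulrnAr mulrnBl.
  by rewrite rep_actM zetaP zetaMn zeta_expn scale1r rep_actM => ->; rewrite ch rep_actZ.
have [v1 [nu [cv1 v10 v1nu]]] :=
  dim_le_eigen (rep_linear (x ^+ n)%g) Ed (@wtZD _ _ _ _ _) xnE cv v0.
(* On [E0] only the kernel of [beta] has to act through [chi]; this space is stable under [x]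
   itself, not just under $x^n$. *)
pose E0 (w : V) := forall h, h \in H -> beta h = 1 -> rep_act h w = char_ext chi h *: w.
have E0l a (u w : V) : E0 u -> E0 w -> E0 (a *: u + w).
  by move=> Eu Ew h hH bh; rewrite rep_actD rep_actZ Eu // Ew // scalerDr !scalerA mulrC.
have E0x (w : V) : E0 w -> E0 (rep_act x w).
  move=> Ew h hH bh; have := xh h w; rewrite bh scale1r => <-.
  by rewrite Ew // rep_actZ.
have [v2 [mu [Ev2 v20 xv2]]] : exists (w : V) mu, [/\ E0 w, w != 0 & rep_act x w = mu *: w].
  (* [v1] is killed by $x^n - \nu$, which splits into linear factors in [x]. *)
  pose p : {poly K} := 'X^n - nu%:P.
  have [r pr] := closed_field_poly_normal p.
  rewrite lead_coefXnsubC // scale1r in pr.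
  have [||||w [a [? ? _ ?]]] := @eigen_of_prod _ _ _ linx r E0 v1 => //.
  - by move=> a w Ew; rewrite addrC -scaleNr; apply: E0l => //; exact: E0x.
  - by move=> h hH _; exact: cv1.
  - rewrite -pr /p pactD // -polyCN -alg_polyC pactZ // pact1 //.
    rewrite (@pactE _ _ _ n.+1) ?size_polyXn // big_ord_recr /= coefXn eqxx scale1r.
    rewrite big1 ?add0r => [|i _]; first by rewrite itx v1nu scaleNr subrr.
    by rewrite coefXn ltn_eqF ?scale0r.
  by exists w, a.
have mu0 : mu != 0.
  by apply: contra_eq_neq xv2 => ->; rewrite scale0r rep_act_eq0.
pose E2 (w : V) := E0 w /\ rep_act x w = mu *: w.
have E2l a (u w : V) : E2 u -> E2 w -> E2 (a *: u + w).
  move=> [Eu xu] [Ew xw]; split; first exact: E0l.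
  by rewrite rep_actD rep_actZ xu xw scalerDr !scalerA mulrC.
have E2v2 : E2 v2 by [].
have [H' [chi' [H'P wt']]] := scalar_pair (E := E2) E2v2 v20.
have injv (c e : K) : c *: v2 = e *: v2 -> c = e.
  by move/eqP; rewrite -subr_eq0 -scalerBl scaler_eq0 (negPf v20) orbF subr_eq0 => /eqP.
have xH' : x \in H' by apply/H'P; exists mu => w [].
have KH' h : h \in H -> beta h = 1 -> h \in H'.
  by move=> hH bh; apply/H'P; exists (char_ext chi h) => w [/(_ h hH bh)].
have wtE2 (w : V) : wt chi' w -> E2 w.
  move=> cw; split=> [h hH bh|].
    rewrite cw ?KH' //; congr (_ *: _); apply: injv.
    by rewrite -wt' ?KH' // Ev2.
  by rewrite cw //; congr (_ *: _); apply: injv; rewrite -wt'.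
exists H', chi'; split=> //; last 2 first.
- by exists v2 => //; exact: wt'.
- apply: dim_le_sub wtE2 _.
  (* The values of [beta] are [n]-th roots of unity, hence finite in number. *)
  have [r rP] := closed_field_poly_normal ('X^n - 1 : {poly K}).
  have mem_r b : b ^+ n = 1 -> b \in r.
    move=> bn; have : root ('X^n - 1) b by rewrite /root !hornerE bn subrr.
    rewrite rP -[1]/(1%:P) lead_coefXnsubC // scale1r root_prod_XsubC //.
  pose s := undup [seq b <- r | `[< exists2 h, h \in H & beta h = b >]].
  have us : uniq s by exact: undup_uniq.
  have sP b : b \in s <-> exists2 h, h \in H & beta h = b.
    rewrite mem_undup mem_filter; split=> [/andP[/asboolP]//|hb].
    by apply/andP; split; [exact/asboolP|case: hb => h _ <-; exact/mem_r/zeta_expn].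
  have /choice[hh hhP] : forall b, exists h, b \in s -> h \in H /\ beta h = b.
    move=> b; have [/sP[h hH hb]|] := boolP (b \in s); first by exists h.
    by exists 1%g.
  pose F (w : V) b := (char_ext chi (hh b))^-1 *: rep_act (hh b) w.
  pose p (w : V) := \sum_(b <- s) F w b.
  have plin a (u w : V) : p (a *: u + w) = a *: p u + p w.
    rewrite /p scaler_sumr -big_split /=; apply: eq_bigr => b _.
    by rewrite /F rep_actD rep_actZ scalerDr !scalerA mulrC.
  have pwt w : E2 w -> wt chi (p w).
    move=> [Ew xw] h hH; rewrite /p rep_act_sum scaler_sumr.
    have sM b : b \in s -> beta h * b \in s.
      by move=> /hhP[bH bb]; apply/sP; exists (h * hh b)%g; rewrite ?gpredM // betaM bb.
    have h0 : beta h != 0.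
      by apply: contra_eq_neq (betaV h) => ->; rewrite mul0r eq_sym oner_neq0.
    (* Multiplication by [beta h] permutes the values, so [h] permutes the averaged terms up to the
       factor [chi h]. *)
    have sperm : perm_eq s [seq beta h * b | b <- s].
      apply: uniq_perm => // [|b]; first by rewrite map_inj_uniq //; exact: mulfI.
      apply/idP/mapP => [bs|[c cs ->]]; last exact: sM.
      exists (beta h^-1%g * b); last by rewrite mulrA betaV mul1r.
      have [bH bb] := hhP _ bs; apply/sP; exists (h^-1 * hh b)%g.
        by rewrite gpredM ?gpredV.
      by rewrite betaM bb.
    rewrite [RHS](perm_big _ sperm) /= big_map !big_seq; apply: eq_bigr => b bs.
    have [bH bb] := hhP _ bs; have [cH cc] := hhP _ (sM _ bs).
    set g := hh (beta h * b) in cH cc *.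
    pose k := (g^-1 * (h * hh b))%g.
    have kH : k \in H by rewrite !(gpredM, gpredV).
    have bk : beta k = 1.
      by rewrite /k !betaM bb -cc mulrC betaV.
    have hk : (h * hh b = g * k)%g by rewrite /k mulVKg.
    rewrite /F rep_actZ -rep_actM hk rep_actM Ew // rep_actZ !scalerA; congr (_ *: _).
    have := congr1 (char_ext chi) hk; rewrite char_extM // [RHS]char_extM // => e.
    have g0 : char_ext chi g != 0 by rewrite char_ext_eq0 cH.
    have b0 : char_ext chi (hh b) != 0 by rewrite char_ext_eq0 bH.
    by apply: (mulfI g0); rewrite mulrCA -e [RHS]mulrCA mulfV // mulr1 mulrC mulfK.
  have pinj w : E2 w -> p w = 0 -> w = 0.
    move=> [Ew xw] pw.
    have s1 : 1 \in s by apply/sP; exists 1%g; rewrite ?gpred1.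
    have TF b : b \in s -> rep_act x (F w b) = (b * mu) *: F w b.
      by move=> /hhP[bH bb];
        rewrite /F rep_actZ xh bb xw rep_actZ !scalerA; congr (_ *: _); ring.
    have /eqP := sum_eigen0 linx mu0 us TF pw s1.
    by rewrite scaler_eq0 invr_eq0 char_ext_eq0 (hhP _ s1).1 rep_act_eq0 => /eqP.
  have E20 : E2 0 by split=> [h _ _|]; rewrite rep_act0 scaler0.
  have p0 : p 0 = 0 by apply: big1 => b _; rewrite /F rep_act0 scaler0.
  have pD u w : p (u + w) = p u + p w by have := plin 1 u w; rewrite !scale1r.
  have pZ a w : p (a *: w) = a *: p w by have := plin a w 0; rewrite p0 !addr0.
  move=> m a Ea fa; apply: (Ed m (fun i => p (a i))) => [i|c ca]; first exact: pwt.
  apply: fa; apply: pinj.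
    apply: (big_ind E2) => // [u w Eu Ew|i _]; first by rewrite -[u]scale1r; exact: E2l.
    by rewrite -[_ *: _]addr0; apply: E2l.
  by rewrite (big_morph p pD p0) -[RHS]ca; apply: eq_bigr => i _; exact: pZ.
- by move=> h hH hx; apply: KH' => //; rewrite /beta hx.
Qed.

End Swap.

(** * Irreducible representations of finite weight are monomial *)

Lemma finite_weight_wt (G : groupType) (K : fieldType) (V : representation G K) :
  finite_weight V -> exists (H : subgroup G) (chi : character K H) (v : V) n,
    [/\ wt chi v, v != 0 & dim_le (wt (V := V) chi) n].
Proof.
move=> [H [chi [[phi tw [z phiz]] [n [b [bP bspan]]]]]].
have tw1 (psi : K^o -> V) : @intertwiners _ _ (char_rep chi) (res_rep H V) psi ->
    forall z : K^o, psi z = (z : K) *: psi (1 : K^o).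
  move=> twp y; rewrite -(intertwinersZ twp (y : K) (1 : K^o)).
  by congr psi; rewrite /GRing.scale /= mulr1.
have wt1 (psi : K^o -> V) : @intertwiners _ _ (char_rep chi) (res_rep H V) psi ->
    wt chi (psi (1 : K^o)).
  move=> twp _ /subg_val[h ->]; rewrite char_ext_val.
  exact: etrans (esym (twp.2 h (1 : K^o))) (intertwinersZ twp (chi h) (1 : K^o)).
exists H, chi, (phi (1 : K^o)), n; split; first exact: wt1.
  by apply: contraNneq phiz => p1; apply/eqP; rewrite (tw1 _ tw) p1 scaler0.
apply: (span_dim_le (b := fun i => b i (1 : K^o))) => v cv.
pose psi (y : K^o) : V := (y : K) *: v.
have [|c psiE] := bspan psi.
  split=> [a x y|g y]; first by rewrite /psi scalerDl scalerA.
  apply: (etrans (y := (y : K) *: (chi g *: v))); first by rewrite scalerA mulrC.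
  rewrite -char_ext_val -cv; last exact: valP.
  by symmetry; exact: rep_actZ.
exists c; have := congr1 (fun f : K^o -> V => f (1 : K^o)) psiE.
rewrite /psi scale1r => ->; rewrite fct_sumE; apply: eq_bigr => i _.
by [].
Qed.

Section Monomial.
Variables (K : closedFieldType) (V : representation UT4 K).
Hypotheses (irrV : irreducible V) (fwV : finite_weight V).

(** A central element preserves the finite-dimensional weight space, so it has an eigenvector there;
    the eigenspace is invariant, hence all of [V]. *)
Lemma central_char : exists zeta : int -> K,
  [/\ forall k (v : V), rep_act (zc k) v = zeta k *: v,
      forall k l, zeta (k + l) = zeta k * zeta l & zeta 0 = 1].
Proof.
have [H [chi [v [n [cv v0 En]]]]] := finite_weight_wt fwV.
have /choice[zeta zP] : forall k, exists a, forall w : V, rep_act (zc k) w = a *: w.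
  move=> k; have zcE (w : V) : wt chi w -> wt chi (rep_act (zc k) w).
    by move=> cw h hH; rewrite -rep_actM -zc_comm rep_actM cw // rep_actZ.
  have [w [a [_ w0 wa]]] :=
    dim_le_eigen (rep_linear (zc k)) En (@wtZD _ _ _ _ _) zcE cv v0.
  exists a; apply: (irreducible_all (W := fun w => rep_act (zc k) w = a *: w) irrV _ _ wa w0).
    by move=> b x y ex ey; rewrite rep_actD rep_actZ ex ey scalerDr !scalerA mulrC.
  by move=> g x ex; rewrite -rep_actM zc_comm rep_actM ex rep_actZ.
have inj (a b : K) : a *: v = b *: v -> a = b.
  by move/eqP; rewrite -subr_eq0 -scalerBl scaler_eq0 (negPf v0) orbF subr_eq0 => /eqP.
exists zeta; split=> // [k l|]; apply: inj.
  by rewrite -zP zcD rep_actM !zP scalerA mulrC.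
rewrite -zP (_ : zc 0 = 1%g) ?rep_act1 ?scale1r //.
by apply: ut_ext; rewrite !utE !ut_mkE.
Qed.

Lemma ut_monomial : exists (H : subgroup UT4) (chi : character K H),
  irreducible (ind_rep chi) /\ rep_iso (ind_rep chi) V.
Proof.
have [zeta [zP zD z0]] := central_char.
have zMn k m : zeta (k *+ m) = zeta k ^+ m.
  by elim: m => [|m IH]; rewrite ?mulr0n ?z0 // mulrS zD IH exprS.
(* Such a pair induces an irreducible representation, and Frobenius reciprocity maps it
   isomorphically onto [V]. *)
suff [H [chi [[v cv v0] lH]]] : exists (H : subgroup UT4) (chi : character K H),
    (exists2 v : V, wt chi v & v != 0) /\ forall y, linked chi chi y -> y \in H.
  have irr := ut_irreducible lH; exists H, chi; split=> //.
  have [phi tw e] := frobenius cv; exists phi => //.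
  by apply: (irr_intertwiner_bij (v := delta chi) irr irrV tw); rewrite e.
(* If [y] is linked and $yHy^{-1} \subseteq H$, then $y^{-1}$ normalises the pair, so it lies in [H]
   by maximality. *)
have linked_norm (H : subgroup UT4) (chi : character K H) y :
    (forall y, (forall h, h \in H -> (h ^ y)%g \in H /\
       char_ext chi (h ^ y)%g = char_ext chi h) -> y \in H) ->
    linked chi chi y -> (forall h, h \in H -> (h ^ y^-1)%g \in H) -> y \in H.
  by move=> nH [_ ly] yH; rewrite -gpredV; apply: nH => h hH;
    split; [exact: yH|apply: ly => //; exact: yH].
have [H0 [chi0 [v0 [n0 [cv0 v00 En0]]]]] := finite_weight_wt fwV.
have [[n npos zn]|nz] := pselect (exists2 n : nat, (0 < n)%N & zeta n%:Z = 1).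
  pose e13 := ut_mk 0 0 0 1 0 0; pose e24 := ut_mk 0 0 0 0 1 0.
  have Z13 : in_Z2 e13 by rewrite /in_Z2 !ut_mkE.
  have Z24 : in_Z2 e24 by rewrite /in_Z2 !ut_mkE.
  have [H1 [chi1 [e13H1 _ [v1 cv1 v10] En1]]] :=
    swap_weight zP zD npos zn Z13 cv0 v00 En0.
  have [H2 [chi2 [e24H2 H12 [v2 cv2 v20] En2]]] :=
    swap_weight zP zD npos zn Z24 cv1 v10 En1.
  (* The second exchange keeps [e13] because it commutes with [e24]. *)
  have e13H2 : e13 \in H2 by apply: H12 => //; rewrite /ell !ut_mkE.
  have [H [chi [H2H [v cv vN] _ nH]]] := max_weight cv2 v20 En2.
  exists H, chi; split; first by exists v.
  have zH k : zc k \in H.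
    apply: nH => h hH; rewrite (_ : (h ^ zc k)%g = h) // conjgE.
    by rewrite -zc_comm mulKg.
  have ZH u : in_Z2 u -> u \in H.
    have expz x k : x \in H -> expgz x k \in H.
      by case: k => m xH; rewrite /expgz ?gpredV gpredXn.
    have ez k : [/\ in_Z2 (expgz e13 k), c13 (expgz e13 k) = k & c24 (expgz e13 k) = 0].
      case: k => m; rewrite /expgz.
        by have [a b c] := Z2_exp m Z13; rewrite b c !ut_mkE mul0rn natz.
      have [[a a' a''] b c] := Z2_exp m.+1 Z13.
      by rewrite /in_Z2 !utE a a' a'' b c !ut_mkE mul0rn natz; split; [split|..]; lia.
    have ez' k : [/\ in_Z2 (expgz e24 k), c13 (expgz e24 k) = 0 & c24 (expgz e24 k) = k].
      case: k => m; rewrite /expgz.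
        by have [a b c] := Z2_exp m Z24; rewrite b c !ut_mkE mul0rn natz.
      have [[a a' a''] b c] := Z2_exp m.+1 Z24.
      by rewrite /in_Z2 !utE a a' a'' b c !ut_mkE mul0rn natz; split; [split|..]; lia.
    move=> [u1 u2 u3]; set p := expgz e13 (c13 u); set q := expgz e24 (c24 u).
    have [[p1 p2 p3] p4 p5] := ez (c13 u); have [[q1 q2 q3] q4 q5] := ez' (c24 u).
    have -> : u = (p * q * zc (c14 u - c14 (p * q)%g))%g.
      apply: ut_ext; rewrite !utE !ut_mkE -/p -/q
        ?p1 ?p2 ?p3 ?p4 ?p5 ?q1 ?q2 ?q3 ?q4 ?q5 ?u1 ?u2 ?u3; ring.
    by rewrite !gpredM // expz // H2H.
  move=> y ly; apply: linked_norm ly _ => // h hH.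
  by have [u uZ ->] := conj_Z2 y^-1%g h; rewrite gpredM // ZH.
have [H [chi [_ [v cv vN] _ nH]]] := max_weight cv0 v00 En0.
exists H, chi; split; first by exists v.
have nz' k n : (0 < n)%N -> zeta (k *+ n) = 1 -> k = 0.
  move=> npos; case: k => [[//|k]|k] zk.
    case: nz; exists (k.+1 * n)%N; first by rewrite muln_gt0.
    by rewrite -zk; congr zeta; rewrite -[Posz k.+1]natz -mulrnA natz.
  case: nz; exists (k.+1 * n)%N; first by rewrite muln_gt0.
  have : zeta (Negz k *+ n) * zeta (k.+1 * n)%:Z = 1.
    rewrite -zD -z0; congr zeta; rewrite NegzE mulNrn -[Posz k.+1]natz -mulrnA natz.
    by rewrite addNr.
  by rewrite zk mul1r.
have zH k : zc k \in H.
  apply: nH => h hH; rewrite (_ : (h ^ zc k)%g = h) // conjgE.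
  by rewrite -zc_comm mulKg.
have perpH x : in_Z2 x -> (forall h, h \in H -> ell x h = 0) -> x \in H.
  move=> xZ xH; apply: nH => h hH; rewrite (_ : (h ^ x)%g = h) // conjgE.
  rewrite -[(h * x)%g]mulg1 (_ : 1%g = zc 0) -?(xH _ hH) -?ell_comm ?mulKg //.
  by rewrite xH //; apply: ut_ext; rewrite !utE !ut_mkE.
move=> y ly; apply: (linked_norm) (ly) _ => // h hH.
have [u uZ hyE] := conj_Z2 y^-1%g h; rewrite hyE gpredM //.
apply: perpH => // g gH.
(* With $(uh)^n$ also $x = (uh)^n h^{-n}$ lies in [H], and its coordinates are [n] times those of
   [u]. As $\zeta(\ell(x,g)) = \chi([x,g]) = 1$ and [zeta] has infinite order, $\ell(u,g)$
   vanishes. *)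
have [n npos hn] := ly.1 h hH; apply: (nz' _ n npos).
rewrite conjXg hyE in hn.
have [xZ x1 x2] := Z2_mulX h n uZ; set x := (_ * _)%g in xZ x1 x2.
have xH : x \in H by rewrite gpredM // gpredV gpredXn.
have -> : ell u g *+ n = ell x g by rewrite /ell x1 x2 mulrnAl mulrnAr mulrnBl.
have inj (a b : K) : a *: v = b *: v -> a = b.
  by move/eqP; rewrite -subr_eq0 -scalerBl scaler_eq0 (negPf vN) orbF subr_eq0 => /eqP.
apply: inj; rewrite -zP (_ : zc _ = [~ x, g])%g; last first.
  by apply: (mulgI (g * x)%g); rewrite -ell_comm // -commgC.
rewrite cv ?gpredR //; congr (_ *: _); rewrite commgEl char_extM ?gpredV //.
by rewrite char_extV // char_extJ // mulVf // char_ext_eq0 xH.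
Qed.

End Monomial.

(** * Isolators, lower central series and ranks *)

Lemma sub_isolator (G : groupType) (A : {pred G}) : {subset A <= isolator A}.
Proof. by move=> x xA; apply/asboolP => L [AL _]; exact: AL. Qed.

Lemma isolator_root (G : groupType) (A : {pred G}) : root_closed (isolator A).
Proof.
move=> g i i0 /asboolP gi; apply/asboolP => L [AL rL].
by apply: (rL g i i0); exact: gi.
Qed.

Lemma isolator_min (G : groupType) (A : {pred G}) (B : subgroup G) :
  root_closed B -> {subset A <= B} -> {subset isolator A <= B}.
Proof. by move=> rB AB x /asboolP; apply. Qed.

(* Conjugation acts trivially on the factors of the lower central series. *)
Lemma ut_conj_subset (A B : subgroup UT4) g :
  {subset A <= B} -> {subset B <= conj_set g A} -> {subset B <= A}.
Proof.
move=> AB BgA.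
(* Write $b = b^g \cdot ((b^g)^{-1} b)$: the first factor lies in [A], and the second lies one step
   deeper in the central series. *)
have step (P Q : UT4 -> Prop) : (forall b, b \in B -> P b -> b \in A) ->
    (forall b, Q b -> P ((b ^ g)^-1 * b)%g) -> forall b, b \in B -> Q b -> b \in A.
  move=> PA QP b bB Qb; have bgA : (b ^ g)%g \in A by exact: BgA.
  rewrite -(mulVKg (b ^ g) b)%g gpredM //; apply: PA (QP _ Qb).
  by rewrite gpredM ?gpredV // AB.
have Z1 b : b \in B -> b = 1%g -> b \in A by move=> _ ->; exact: gpred1.
have Z2 : forall b, b \in B -> in_Z2 b /\ c13 b = 0 /\ c24 b = 0 -> b \in A.
  apply: step Z1 _ => b [[b1 b2 b3] [b4 b5]].
  by apply: ut_ext; rewrite !conjgE !utE ?b1 ?b2 ?b3 ?b4 ?b5; ring.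
have Z3 : forall b, b \in B -> in_Z2 b -> b \in A.
  apply: step Z2 _ => b [b1 b2 b3].
  by rewrite /in_Z2 !conjgE !utE ?b1 ?b2 ?b3; split; [split|split]; ring.
move=> b bB; apply: (step _ (fun=> True) Z3) => // {bB}b _.
by rewrite /in_Z2 !conjgE !utE; split; ring.
Qed.

(** Two steps suffice: conjugating the first pair by the linked element [x] puts its isolator inside
    that of the second, and [w] gives the reverse inclusion up to conjugation, so [ut_conj_subset]
    makes them equal. *)
Lemma iso_X_rel (K : fieldType) (y1 y2 : irr_pair UT4 K) :
  rep_iso (ip_ind y1) (ip_ind y2) -> X_rel y1 y2.
Proof.
move=> iso.
have lnk (z1 z2 : irr_pair UT4 K) : rep_iso (ip_ind z1) (ip_ind z2) ->
    exists y, linked (ip_char z1) (ip_char z2) y.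
  move=> [phi tw bij].
  have f0 : phi (delta (ip_char z1)) != 0.
    rewrite -(intertwiners0 tw) (inj_eq (bij_inj bij)); exact: delta_neq0.
  have [y fy] := ind_neq0 f0; exists y; apply: wt_linked fy.
  by move=> h hH; rewrite -tw.2 delta_wt // (intertwinersZ tw).
have [x [xP _]] := lnk _ _ iso; have [w [wP _]] := lnk _ _ (rep_iso_sym iso).
have [H' [chi' [H'E chiE iso']]] := conj_character (ip_char y1) x.
pose y' := IrrPair (irreducible_iso iso' (ip_irr y1)).
apply/asboolP; apply: (rst_trans _ _ _ y').
  apply: rst_step; apply: (@X_step_conj _ _ _ _ x); split=> // u z e.
  by rewrite -!char_ext_val /= chiE ?e //; exact: valP.
apply: rst_step; apply: X_step_star; last exact: rep_iso_trans (rep_iso_sym iso') iso.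
have s12 : {subset isolator H' <= isolator (ip_sub y2)}.
  apply: isolator_min; first exact: isolator_root.
  move=> z; rewrite H'E conj_setE => /xP[n n0]; rewrite -conjXg conjgK => zn.
  by apply: (isolator_root n0); exact: sub_isolator.
have s21 : {subset isolator (ip_sub y2) <= conj_set (w^-1 * x^-1)%g (isolator H')}.
  move=> z zH; rewrite (isolator_conj (g := (w^-1 * x^-1)%g) (A := H') (fun=> erefl)).
  move: z zH; apply: isolator_min; first exact: isolator_root.
  move=> z /wP[n n0 zn]; apply: (isolator_root n0); apply: sub_isolator.
  by rewrite conj_setE H'E conj_setE conjgM conjgKV.
move=> z; apply/idP/idP; first exact: s12.
exact: ut_conj_subset s12 s21 z.
Qed.

(** * The lower central series in coordinates *)

Lemma comm_e12_e23 k :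
  [~ ut_mk 1 0 0 0 0 0, ut_mk 0 k 0 0 0 0]%g = ut_mk 0 0 0 k 0 0.
Proof. by apply: ut_ext; rewrite commgEl conjgE !utE !ut_mkE; ring. Qed.

Lemma comm_e23_e34 k :
  [~ ut_mk 0 1 0 0 0 0, ut_mk 0 0 k 0 0 0]%g = ut_mk 0 0 0 0 k 0.
Proof. by apply: ut_ext; rewrite commgEl conjgE !utE !ut_mkE; ring. Qed.

Lemma comm_e12_e24 k :
  [~ ut_mk 1 0 0 0 0 0, ut_mk 0 0 0 0 k 0]%g = ut_mk 0 0 0 0 0 k.
Proof. by apply: ut_ext; rewrite commgEl conjgE !utE !ut_mkE; ring. Qed.

Lemma gamma1_UT4 x : (x \in gamma1 UT4) <-> in_Z2 x.
Proof.
split=> [/asboolP xg|[x1 x2 x3]].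
  have [|a b [? ? ?] [? ? ?]|a [? ? ?]|L LP] := @mk_subgroup _ in_Z2.
  - by rewrite /in_Z2 !utE.
  - by rewrite /in_Z2 !utE; split; lia.
  - by rewrite /in_Z2 !utE; split; lia.
  apply/LP/xg => a b _ _; apply/LP; rewrite /in_Z2 commgEl conjgE !utE.
  by split; ring.
apply/asboolP => L LP.
have -> : x = ([~ ut_mk 1 0 0 0 0 0, ut_mk 0 (c13 x) 0 0 0 0] *
    [~ ut_mk 0 1 0 0 0 0, ut_mk 0 0 (c24 x) 0 0 0] *
    [~ ut_mk 1 0 0 0 0 0, ut_mk 0 0 0 0 (c14 x) 0])%g.
  rewrite comm_e12_e23 comm_e23_e34 comm_e12_e24.
  by apply: ut_ext; rewrite !utE !ut_mkE ?x1 ?x2 ?x3; ring.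
by apply: gpredM; [apply: gpredM|]; exact: LP.
Qed.

Lemma gamma2_UT4 x : (x \in gamma2 UT4) <-> in_Z2 x /\ c13 x = 0 /\ c24 x = 0.
Proof.
split=> [/asboolP xg|[[x1 x2 x3] [x4 x5]]].
  have [|a b [[? ? ?] [? ?]] [[? ? ?] [? ?]]|a [[a1 ? ?] [? ?]]|L LP] :=
    @mk_subgroup _ (fun x => in_Z2 x /\ c13 x = 0 /\ c24 x = 0).
  - by rewrite /in_Z2 !utE.
  - by rewrite /in_Z2 !utE; split; [split|split]; nia.
  - by rewrite /in_Z2 !utE; split; [split|split]; nia.
  apply/LP/xg => a b _ /gamma1_UT4[b1 b2 b3]; apply/LP.
  rewrite /in_Z2 commgEl conjgE !utE b1 b2 b3.
  by split; [split|split]; ring.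
apply/asboolP => L LP.
have -> : x = [~ ut_mk 1 0 0 0 0 0, ut_mk 0 0 0 0 (c14 x) 0]%g.
  by rewrite comm_e12_e24; apply: ut_ext; rewrite !ut_mkE.
by apply: LP => //; apply/gamma1_UT4; rewrite /in_Z2 !ut_mkE.
Qed.

(** * Ranks as linear independence of integer vectors *)

Definition zindep n k (r : 'I_n -> 'I_k -> int) := forall m : 'I_n -> int,
  (forall j, \sum_i m i * r i j = 0) -> forall i, m i = 0.

(** More than [k] rows are dependent over the rationals; multiplying by the product [d] of the
    denominators gives an integer relation. *)
Lemma zindep_le n k (r : 'I_n -> 'I_k -> int) : zindep r -> (n <= k)%N.
Proof.
move=> rI; rewrite leqNgt; apply/negP => kn.
have [c [[i ci] cP]] := mx_row_dep (\matrix_(i, j) (r i j)%:~R : 'M[rat]_(n, k)) kn.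
pose d := \prod_i denq (c i); pose m i := numq (c i) * \prod_(j | j != i) denq (c j).
have mE l : (m l)%:~R = c l * d%:~R :> rat.
  rewrite /m /d [in RHS](bigD1 l) //= !intrM mulrA; congr (_ * _).
  by rewrite {2}(esym (divq_num_den (c l))) mulfVK // intr_eq0 denq_neq0.
have d0 : d != 0 by apply/prodf_neq0 => j _; exact: denq_neq0.
have /rI/(_ i) mi : forall j, \sum_i m i * r i j = 0.
  move=> j; apply/eqP; rewrite -(intr_eq0 rat) rmorph_sum /=; apply/eqP.
  under eq_bigr do rewrite intrM mE mulrAC.
  rewrite -mulr_suml; have := cP j; under eq_bigr do rewrite mxE.
  by move=> ->; rewrite mul0r.
have := mE i; rewrite mi => /esym/eqP.
by rewrite mulf_eq0 (negPf ci) intr_eq0 (negPf d0).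
Qed.

Lemma not_zindep n k (r : 'I_n -> 'I_k -> int) : ~ zindep r ->
  exists m : 'I_n -> int, (exists i, m i != 0) /\ forall j, \sum_i m i * r i j = 0.
Proof.
move=> /existsNP[m /not_implyP[mr /existsNP[i /eqP mi]]].
by exists m; split=> //; exists i.
Qed.

(** Coordinates on $G/\gamma_1$; [co2] gives those on $\gamma_1/\gamma_2$. *)
Definition co1 (g : UT4) (j : 'I_3) : int := nth 0 [:: c12 g; c23 g; c34 g] j.
Definition co2 (g : UT4) (j : 'I_2) : int := nth 0 [:: c13 g; c24 g] j.

Lemma co1M g h j : co1 (g * h)%g j = co1 g j + co1 h j.
Proof. by case: j => [[|[|[|]]]] // ij; rewrite /co1 /= !utE. Qed.

Lemma co1_1 j : co1 1%g j = 0.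
Proof. by case: j => [[|[|[|]]]] // ij; rewrite /co1 /= !utE. Qed.

Lemma co1_eq0 g : (forall j, co1 g j = 0) <-> in_Z2 g.
Proof.
split=> [h|[? ? ?] [[|[|[|]]]]] //.
by split; [have := h (inord 0)|have := h (inord 1)|have := h (inord 2)];
  rewrite /co1 inordK.
Qed.

Lemma co2_eq0 g : (forall j, co2 g j = 0) <-> c13 g = 0 /\ c24 g = 0.
Proof.
split=> [h|[? ?] [[|[|]]]] //.
by split; [have := h (inord 0)|have := h (inord 1)]; rewrite /co2 inordK.
Qed.

Lemma co1X g k j : co1 (expgz g k) j = k * co1 g j.
Proof.
have P n : co1 (g ^+ n)%g j = n%:Z * co1 g j.
  elim: n => [|n IH]; first by rewrite expg0 co1_1 mul0r.
  by rewrite expgS co1M IH; lia.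
case: k => n; rewrite /expgz // NegzE mulNr -P.
have := co1M (g ^+ n.+1)%g (g ^- n.+1)%g j; rewrite mulgV co1_1; lia.
Qed.

Lemma co1_prod n (a : 'I_n -> UT4) m j :
  co1 (\prod_i expgz (a i) (m i))%g j = \sum_i m i * co1 (a i) j.
Proof.
rewrite (big_morph (co1^~ j) (fun g h => co1M g h j) (co1_1 j)).
by apply: eq_bigr => i _; rewrite co1X.
Qed.

Lemma co2M g h j : in_Z2 g -> co2 (g * h)%g j = co2 g j + co2 h j.
Proof.
move=> [g1 g2 g3]; case: j => [[|[|]]] // ij; rewrite /co2 /= !utE ?g1 ?g2; ring.
Qed.

Lemma co2_prod n (a : 'I_n -> UT4) m j : (forall i, in_Z2 (a i)) ->
  in_Z2 (\prod_i expgz (a i) (m i))%g /\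
  co2 (\prod_i expgz (a i) (m i))%g j = \sum_i m i * co2 (a i) j.
Proof.
move=> aZ; have P i : in_Z2 (expgz (a i) (m i)) /\
    co2 (expgz (a i) (m i)) j = m i * co2 (a i) j.
  have Pn k : in_Z2 (a i ^+ k)%g /\ co2 (a i ^+ k)%g j = k%:Z * co2 (a i) j.
    have [Z e1 e2] := Z2_exp k (aZ i); split=> //.
    by case: (j) => [[|[|]]] // ij; rewrite /co2 /= ?e1 ?e2 -mulr_natl natz.
  case: (m i) => k; rewrite /expgz //; have [[k1 k2 k3] e] := Pn k.+1.
  have Z : in_Z2 (a i ^+ k.+1)%g by [].
  split; first by rewrite /in_Z2 !utE k1 k2 k3.
  rewrite NegzE mulNr -e; have := co2M (a i ^- k.+1)%g j Z; rewrite mulgV.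
  have -> : co2 1%g j = 0 by case: (j) => [[|[|]]] // ij; rewrite /co2 /= !utE.
  lia.
elim/big_rec2: _ => [|i s g _ [gZ ge]].
  by split; [rewrite /in_Z2 !utE|case: (j) => [[|[|]]] // ij; rewrite /co2 /= !utE].
have [Z e] := P i; split; last by rewrite co2M // e ge.
by move: Z gZ => [? ? ?] [? ? ?]; rewrite /in_Z2 !utE; split; lia.
Qed.

(** [co1] is a homomorphism with kernel $[G,G]$, so independence can be read off coordinates. *)
Lemma indep1P (H : subgroup UT4) n (a : 'I_n -> UT4) :
  indep_mod H [predI H & gamma1 UT4] a <->
  (forall i, a i \in H) /\ zindep (fun i => co1 (a i)).
Proof.
have prodH m : (forall i, a i \in H) -> (\prod_i expgz (a i) (m i))%g \in H.
  move=> aH; apply: gpred_prod => i _.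
  by case: (m i) => k; rewrite /expgz ?gpredV gpredXn.
split=> -[aH ia]; split=> // m mP.
  apply: ia; rewrite !inE prodH //; apply/gamma1_UT4/co1_eq0 => j.
  by rewrite co1_prod.
apply: ia => j; rewrite -co1_prod.
by move: mP; rewrite !inE => /andP[_ /gamma1_UT4/co1_eq0].
Qed.

Lemma indep2P (H : subgroup UT4) n (a : 'I_n -> UT4) :
  indep_mod [predI H & gamma1 UT4] [predI H & gamma2 UT4] a <->
  (forall i, a i \in H /\ in_Z2 (a i)) /\ zindep (fun i => co2 (a i)).
Proof.
have prodH m : (forall i, a i \in H) -> (\prod_i expgz (a i) (m i))%g \in H.
  move=> aH; apply: gpred_prod => i _.
  by case: (m i) => k; rewrite /expgz ?gpredV gpredXn.
split=> -[aH ia].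
  have aH' i : a i \in H /\ in_Z2 (a i).
    by have := aH i; rewrite !inE => /andP[? /gamma1_UT4].
  split=> // m mP; apply: ia; rewrite !inE prodH => [|i]; last by case: (aH' i).
  apply/gamma2_UT4; have P j := co2_prod m j (fun i => (aH' i).2).
  split; first by case: (P ord0).
  by apply/co2_eq0 => j; rewrite (P j).2.
split=> [i|m mP]; first by rewrite !inE (aH i).1; apply/gamma1_UT4; case: (aH i).
apply: ia => j; rewrite -(co2_prod m j (fun i => (aH i).2)).2.
by move: mP; rewrite !inE => /andP[_ /gamma2_UT4[_ /co2_eq0]].
Qed.

Lemma has_rank_ex (G : groupType) (A B : {pred G}) k :
  (forall n (a : 'I_n -> G), indep_mod A B a -> (n <= k)%N) ->
  exists2 r, (r <= k)%N & has_rank A B r.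
Proof.
move=> bnd; pose P n := `[< exists a : 'I_n -> G, indep_mod A B a >].
have exP : exists n, P n.
  exists 0%N; apply/asboolP; exists (fun=> 1%g).
  by split=> [[]|m _ []].
have Pk n : P n -> (n <= k)%N by move=> /asboolP[a /bnd].
case: (ex_maxnP exP Pk) => r Pr rmax; exists r; first exact: Pk.
by split=> [|n a ia]; [exact/asboolP|apply: rmax; apply/asboolP; exists a].
Qed.

Lemma ut_rk1_ex (H : subgroup UT4) : exists2 r, (r <= 3)%N & has_rk1 H r.
Proof. by apply: has_rank_ex => n a /indep1P[_ /zindep_le]. Qed.

Lemma ut_rk2_ex (H : subgroup UT4) : exists2 r, (r <= 2)%N & has_rk2 H r.
Proof. by apply: has_rank_ex => n a /indep2P[_ /zindep_le]. Qed.

(* Up to the factor 2, the off-diagonal entries of the logarithm; they are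
   multiplied by [n] under [g |-> g ^+ n]. *)
Definition log13 (g : UT4) : int := 2 * c13 g - c12 g * c23 g.
Definition log24 (g : UT4) : int := 2 * c24 g - c23 g * c34 g.

Lemma ut_expZ g n : [/\ c12 (g ^+ n)%g = n%:Z * c12 g,
  c23 (g ^+ n)%g = n%:Z * c23 g & c34 (g ^+ n)%g = n%:Z * c34 g].
Proof.
have mz (z : int) : z *+ n = n%:Z * z by rewrite -mulr_natl natz.
by have [-> -> ->] := ut_expE g n; rewrite !mz.
Qed.

Lemma logX g n : [/\ log13 (g ^+ n)%g = n%:Z * log13 g & log24 (g ^+ n)%g = n%:Z * log24 g].
Proof.
have step (m a b d d' : int) : 2 * d' - (m * a) * (m * b) = m * (2 * d - a * b) ->
    2 * (d + a * (m * b) + d') - (a + m * a) * (b + m * b) = (1 + m) * (2 * d - a * b).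
  move=> e; transitivity (2 * d - a * b + (2 * d' - m * a * (m * b))); first ring.
  by rewrite e; ring.
elim: n => [|n [IH1 IH2]].
  by rewrite expg0 /log13 /log24 c13_1 c24_1 c12_1 c23_1 c34_1; split; ring.
have [e1 e2 e3] := ut_expZ g n; rewrite /log13 /log24 e1 e2 e3 in IH1 IH2 *.
rewrite expgS c13M c24M c12M c23M c34M e1 e2 e3 intS.
by split; apply: step.
Qed.

(** This says $\log h = n \log g$ modulo the centre. *)
Definition log_scale (n : nat) (g h : UT4) :=
  [/\ c12 h = n%:Z * c12 g, c23 h = n%:Z * c23 g & c34 h = n%:Z * c34 g] /\
  log13 h = n%:Z * log13 g /\ log24 h = n%:Z * log24 g.

Lemma log_scaleX g n : log_scale n g (g ^+ n)%g.
Proof.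
have [e1 e2 e3] := ut_expZ g n; have [l1 l2] := logX g n.
by rewrite /log_scale e1 e2 e3 l1 l2.
Qed.

Lemma log_scale_trans m n g h k : log_scale m g h -> log_scale n h k ->
  log_scale (m * n) g k.
Proof.
move=> [[a1 a2 a3] [a4 a5]] [[b1 b2 b3] [b4 b5]].
rewrite /log_scale b1 b2 b3 b4 b5 a1 a2 a3 a4 a5 PoszM.
by split; [split|split]; ring.
Qed.

(** Modulo the centre, $2n^2 \log(gg') = 2n(\log h + \log h') + [\log h, \log h']$, while
    $\log(h^{2n} h'^{2n})$ has $2n^2$ times the same bracket; this explains the exponent $1 -
    2n^2$. *)
Lemma log_scaleM n g g' h h' : log_scale n g h -> log_scale n g' h' ->
  log_scale (2 * n ^ 2) (g * g')%g
    (h ^+ (2 * n) * h' ^+ (2 * n) * expgz [~ h, h'] (1 - 2 * n%:Z ^+ 2))%g.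
Proof.
move=> [[a1 a2 a3] [a4 a5]] [[b1 b2 b3] [b4 b5]].
have [[p1 p2 p3] [p4 p5]] := log_scaleX h (2 * n).
have [[q1 q2 q3] [q4 q5]] := log_scaleX h' (2 * n).
set k := 1 - _; pose c := [~ h, h']%g.
have cZ : in_Z2 c by rewrite /in_Z2 /c commgEl conjgE !utE; split; ring.
have [rZ r1] := co2_prod (fun _ : 'I_1 => k) (inord 0) (fun=> cZ).
have [_ r2] := co2_prod (fun _ : 'I_1 => k) (inord 1) (fun=> cZ).
rewrite !big_ord1 /co2 !inordK //= in rZ r1 r2; move: rZ => [r3 r4 r5].
have c1 : c13 c = c12 h * c23 h' - c23 h * c12 h'.
  by rewrite /c commgEl conjgE !utE; ring.
have c2 : c24 c = c23 h * c34 h' - c34 h * c23 h'.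
  by rewrite /c commgEl conjgE !utE; ring.
rewrite /log_scale /log13 /log24 !utE -/c r1 r2 r3 r4 r5 c1 c2 p1 p2 p3 q1 q2 q3.
rewrite !PoszM in p4 p5 q4 q5 *.
have p4' : 2 * c13 (h ^+ (2 * n))%g =
    2 * n%:Z * (n%:Z * log13 g) + 2 * n%:Z * c12 h * (2 * n%:Z * c23 h).
  by rewrite -a4 -p4 /log13 p1 p2 !PoszM; ring.
have p5' : 2 * c24 (h ^+ (2 * n))%g =
    2 * n%:Z * (n%:Z * log24 g) + 2 * n%:Z * c23 h * (2 * n%:Z * c34 h).
  by rewrite -a5 -p5 /log24 p2 p3 !PoszM; ring.
have q4' : 2 * c13 (h' ^+ (2 * n))%g =
    2 * n%:Z * (n%:Z * log13 g') + 2 * n%:Z * c12 h' * (2 * n%:Z * c23 h').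
  by rewrite -b4 -q4 /log13 q1 q2 !PoszM; ring.
have q5' : 2 * c24 (h' ^+ (2 * n))%g =
    2 * n%:Z * (n%:Z * log24 g') + 2 * n%:Z * c23 h' * (2 * n%:Z * c34 h').
  by rewrite -b5 -q5 /log24 q2 q3 !PoszM; ring.
split; first by rewrite a1 a2 a3 b1 b2 b3; split; ring.
rewrite !mulrDr p4' p5' q4' q5' /k a1 a2 a3 b1 b2 b3 /log13 /log24.
by split; ring.
Qed.

(* Up to scale, the logarithms of elements of [H] form a subgroup by the
   Baker-Campbell-Hausdorff formula. *)
Lemma isolator_log (H : subgroup UT4) a : a \in isolator H ->
  exists n h, [/\ (0 < n)%N, h \in H & log_scale n a h].
Proof.
pose P a := exists n h, [/\ (0 < n)%N, h \in H & log_scale n a h].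
have expH h k : h \in H -> expgz h k \in H.
  by move=> hH; case: k => m; rewrite /expgz ?gpredV gpredXn.
have [||x [n [h [n0 hH s]]]|L LP] := @mk_subgroup _ P.
- by exists 1%N, 1%g; split; rewrite ?gpred1 // -{2}(expg1 1%g); exact: log_scaleX.
- move=> x y [n [h [n0 hH sx]]] [m [k [m0 kH sy]]].
  (* Bring both elements to the common scale [n * m]. *)
  have sx' := log_scale_trans sx (log_scaleX h m).
  have := log_scale_trans sy (log_scaleX k n); rewrite mulnC => sy'.
  exists (2 * (n * m) ^ 2)%N; eexists; split; last exact: log_scaleM sx' sy'.
    by rewrite muln_gt0 expn_gt0 muln_gt0 n0 m0.
  by rewrite !gpredM ?expH ?gpredXn ?gpredR ?gpredXn.
- exists n, h^-1%g; split; rewrite ?gpredV //; move: s => [[a1 a2 a3] [a4 a5]].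
  rewrite /log_scale /log13 /log24 !utE a1 a2 a3 in a4 a5 *.
  by split; [split|split]; lia.
move=> aH; apply/LP; move: a aH; apply: isolator_min => [g i i0 /LP|h hH].
  move=> [n [h [n0 hH s]]]; apply/LP; exists (i * n)%N, h; split=> //.
    by rewrite muln_gt0 i0.
  exact: log_scale_trans (log_scaleX g i) s.
by apply/LP; exists 1%N, h; split=> //; rewrite -{2}(expg1 h); exact: log_scaleX.
Qed.

Lemma zindep_scale n k (r r' : 'I_n -> 'I_k -> int) (d : 'I_n -> nat) :
  (forall i, 0 < d i)%N -> (forall i j, r' i j = (d i)%:Z * r i j) ->
  zindep r -> zindep r'.
Proof.
move=> d0 rE ir m mr i; have /eqP : m i * (d i)%:Z = 0.
  apply: (ir (fun i => m i * (d i)%:Z)) => j; rewrite -[RHS](mr j).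
  by apply: eq_bigr => l _; rewrite rE mulrA.
by rewrite mulf_eq0 => /orP[/eqP//|]; have := d0 i; case: (d i).
Qed.

(** By [isolator_log], the logarithm of each conjugated element of [A] has a multiple coming from
    [B]. Conjugation fixes the coordinates on the successive quotients, so independent families of
    [A] yield families of [B] of the same size. *)
Lemma Xi_rank (K : fieldType) (H1 H2 : weight_subgroup UT4 K) r1 r2 s1 s2 :
  Xi_rel H1 H2 -> has_rk1 H1 r1 -> has_rk2 H1 r2 ->
  has_rk1 H2 s1 -> has_rk2 H2 s2 -> (r1, r2) = (s1, s2).
Proof.
have le (A B : weight_subgroup UT4 K) p1 p2 q1 q2 : Xi_rel A B ->
    has_rk1 A p1 -> has_rk2 A p2 -> has_rk1 B q1 -> has_rk2 B q2 ->
    (p1 <= q1)%N && (p2 <= q2)%N.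
  move=> /asboolP[g gE] [[a /indep1P[aA ia]] _] [[b /indep2P[bA ib]] _] [_ max1] [_ max2].
  have lift x : x \in ws_sub A -> exists nh : nat * UT4,
      [/\ (0 < nh.1)%N, nh.2 \in ws_sub B & log_scale nh.1 (x ^ g^-1)%g nh.2].
    move=> xA; have /isolator_log[n [h hP]] : (x ^ g^-1)%g \in isolator B.
      by rewrite -gE conj_setE conjgKV; exact: sub_isolator.
    by exists (n, h).
  apply/andP; split.
    have /choice[c cP] : forall i, exists nh : nat * UT4,
      [/\ (0 < nh.1)%N, nh.2 \in ws_sub B & log_scale nh.1 (a i ^ g^-1)%g nh.2].
      by move=> i; exact: lift.
    apply: (max1 _ (fun i => (c i).2)); apply/indep1P; split=> [i|]; first by case: (cP i).
    apply: (zindep_scale (d := fun i => (c i).1) _ _ ia) => [i|i]; first by case: (cP i).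
    have [_ _ [[e1 e2 e3] _]] := cP i.
    by case=> [[|[|[|]]]] // ij; rewrite /co1 /= ?e1 ?e2 ?e3 conjgE !utE; congr (_ * _); ring.
  have /choice[c cP] : forall i, exists nh : nat * UT4,
    [/\ (0 < nh.1)%N, nh.2 \in ws_sub B & log_scale nh.1 (b i ^ g^-1)%g nh.2].
    by move=> i; apply: lift; case: (bA i).
  have bZ i : in_Z2 (c i).2.
    have [_ _ [[e1 e2 e3] _]] := cP i; have [_ [b1 b2 b3]] := bA i.
    by rewrite /in_Z2 e1 e2 e3 conjgE !utE b1 b2 b3; split; ring.
  apply: (max2 _ (fun i => (c i).2)); apply/indep2P; split=> [i|]; first by case: (cP i).
  apply: (zindep_scale (d := fun i => (c i).1) _ _ ib) => [i|i]; first by case: (cP i).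
  have [_ _ [[e1 e2 e3] [l1 l2]]] := cP i; have [_ [b1 b2 b3]] := bA i.
  have [z1 z2 z3] := bZ i; move: l1 l2.
  rewrite /log13 /log24 z1 z2 z3 conjgE !utE b1 b2 b3 => l1 l2.
  have half (p q : int) : 2 * p - 0 * 0 = 2 * q -> p = q by lia.
  case=> [[|[|]]] // ij; rewrite /co2 /=; apply: half; [rewrite l1|rewrite l2]; ring.
move=> X12 h11 h12 h21 h22; congr (_, _); apply/eqP; rewrite eqn_leq.
  by case/andP: (le _ _ _ _ _ _ X12 h11 h12 h21 h22) => -> _;
    case/andP: (le _ _ _ _ _ _ (Xi_rel_symP X12) h21 h22 h11 h12).
by case/andP: (le _ _ _ _ _ _ X12 h11 h12 h21 h22) => _ ->;
  case/andP: (le _ _ _ _ _ _ (Xi_rel_symP X12) h21 h22 h11 h12).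
Qed.

(** * Classification *)

Import Order.TTheory Num.Theory.

(** To avoid one point [c], keep the outer third of the interval on the other side of its
    midpoint. *)
Lemma real_avoid_seq (R : realType) (s : seq R) (a b : R) : a < b ->
  exists a' b', [/\ a <= a', a' < b', b' <= b & forall x, x \in s -> ~ (a' <= x <= b')].
Proof.
elim: s a b => [|c s IH] a b ab; first by exists a, b.
pose d := (b - a) / 3; have d0 : 0 < d by rewrite /d; lra.
have [a1 [b1 [ab1 la lb nc]]] : exists a1 b1,
    [/\ a1 < b1, a <= a1, b1 <= b & ~ (a1 <= c <= b1)].
  have [ca|ca] := ltP c (a + d + d / 2).
    by exists (a + d + d), b; rewrite /d in ca *; split; [lra|lra|lra|move=> /andP[]; lra].
  by exists a, (a + d); rewrite /d in ca *; split; [lra|lra|lra|move=> /andP[]; lra].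
have [a' [b' [? ? ? ns]]] := IH _ _ ab1; exists a', b'; split=> //; [lra|lra|].
move=> x; rewrite inE => /predU1P[->|/ns//] /andP[? ?].
by apply: nc; apply/andP; split; lra.
Qed.

(** Cantor's argument: if all fibres were finite, nested closed intervals avoiding them one after
    the other would share a point [z], contradicting step [f z]. *)
Lemma real_uncountable (R : realType) (f : R -> nat) :
  exists k, forall n, exists s : seq R,
    [/\ uniq s, size s = n & forall x, x \in s -> f x = k].
Proof.
have [|/forallNP fin] := pselect (exists k, infinite_set [set x | f x = k]%classic).
  move=> [k inf]; exists k => n; have [B BA Bn] := infinite_set_fset n inf.
  exists (take n (finmap.enum_fset B)); split=> [||x /mem_take]; last exact: BA.
    exact/take_uniq/finmap.fset_uniq.
  exact: size_takel.
have /choice[F FP] : forall k, exists s : seq R, forall x, f x = k -> x \in s.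
  move=> k; have /contrapT/finite_seqP[s sE] := fin k; exists s => x fx.
  by have : [set x | f x = k]%classic x by []; rewrite sE.
have /choice[st stP] : forall kp : nat * (R * R), exists q : R * R, kp.2.1 < kp.2.2 ->
    [/\ kp.2.1 <= q.1, q.1 < q.2, q.2 <= kp.2.2 &
      forall x, x \in F kp.1 -> ~ (q.1 <= x <= q.2)].
  move=> [k [a b]] /=; have [ab|ba] := ltP a b; last by exists (a, b).
  by have [a' [b' h]] := real_avoid_seq (F k) ab; exists (a', b').
pose fix u n : R * R := if n is m.+1 then st (m, u m) else (0, 1).
have uP n : (u n).1 < (u n).2.
  by elim: n => [|n IH] /=; [exact: ltr01|case: (stP (n, u n) IH)].
have uS n : [/\ (u n).1 <= (u n.+1).1, (u n.+1).2 <= (u n).2 &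
    forall x, x \in F n -> ~ ((u n.+1).1 <= x <= (u n.+1).2)].
  by have [] := stP (n, u n) (uP n).
have u1 m n : (m <= n)%N -> (u m).1 <= (u n).1.
  elim: n => [|n IH]; first by rewrite leqn0 => /eqP->.
  rewrite leq_eqVlt => /predU1P[->//|/IH h]; apply: le_trans h _; by case: (uS n).
have u2 m n : (m <= n)%N -> (u n).2 <= (u m).2.
  elim: n => [|n IH]; first by rewrite leqn0 => /eqP->.
  rewrite leq_eqVlt => /predU1P[->//|/IH h]; apply: le_trans _ h; by case: (uS n).
have u12 m n : (u m).1 <= (u n).2.
  have [mn|nm] := leqP m n.
    by apply: le_trans (u1 _ _ mn) _; exact/ltW.
  by apply: le_trans (u2 _ _ (ltnW nm)); exact/ltW.
pose A : set R := [set x | exists n, x = (u n).1]%classic.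
pose z := sup A.
have zn n : (u n).1 <= z <= (u n).2.
  apply/andP; split.
    by apply: ub_le_sup; [exists (u 0%N).2 => _ [m ->]; exact: u12|exists n].
  by apply: ge_sup; [exists (u 0%N).1; exists 0%N|move=> _ [m ->]; exact: u12].
by have [_ _ /(_ z (FP _ _ erefl))] := uS (f z); case; exact: zn.
Qed.

Lemma complex_uncountable (R : realType) (f : R[i] -> nat) :
  exists k, forall n, exists s : seq R[i],
    [/\ uniq s, size s = n & forall x, x \in s -> f x = k].
Proof.
have [k kP] := real_uncountable (fun x : R => f (x%:C)%C); exists k => n.
have [s [us sn sk]] := kP n; exists (map (fun x : R => (x%:C)%C) s); split.
- by rewrite map_inj_uniq // => x y [].
- by rewrite size_map.
- by move=> _ /mapP[x xs ->]; exact: sk.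
Qed.

(** * The possible ranks of a self-stabilising pair *)

Section Ranks.
Variables (K : fieldType) (H : subgroup UT4) (chi : character K H).
Hypothesis nH : forall y, (forall h, h \in H -> (h ^ y)%g \in H /\
  char_ext chi (h ^ y)%g = char_ext chi h) -> y \in H.

Let fixH y : (forall h, h \in H -> (h ^ y)%g = h) -> y \in H.
Proof. by move=> yP; apply: nH => h /[dup] hH /yP ->. Qed.

Let perpH x : in_Z2 x -> (forall h, h \in H -> ell x h = 0) -> x \in H.
Proof.
move=> [x1 x2 x3] xH; apply: fixH => h /xH; rewrite /ell => e.
have e' : c13 x * c34 h = c12 h * c24 x by apply/eqP; rewrite -subr_eq0 e.
apply: ut_ext; rewrite conjgE !utE ?x1 ?x2 ?x3; try ring.
transitivity (c14 h + (c12 h * c24 x - c13 x * c34 h)); first ring.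
by rewrite e' subrr addr0.
Qed.

Let dep1 n (a : 'I_n -> UT4) r : has_rk1 H r -> (forall i, a i \in H) -> (r < n)%N ->
  exists m : 'I_n -> int, (exists i, m i != 0) /\ forall j, \sum_i m i * co1 (a i) j = 0.
Proof.
move=> [_ rmax] aH rn; apply: not_zindep => ai.
have : (n <= r)%N by apply: (rmax _ a); apply/indep1P.
by rewrite leqNgt rn.
Qed.

(** Otherwise [H] lies in $[G,G]$, which commutes with the elementary matrix at position (2,3); that
    matrix would then belong to [H]. *)
Lemma ut_rk1_neq0 : ~ has_rk1 H 0.
Proof.
move=> r0; have HZ h : h \in H -> in_Z2 h.
  move=> hH; have [m [[i mi] mP]] := dep1 (a := fun _ : 'I_1 => h) r0 (fun=> hH) isT.
  rewrite (ord1 i) in mi; apply/co1_eq0 => j; have := mP j; rewrite big_ord1 => /eqP.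
  by rewrite mulf_eq0 (negPf mi) => /eqP.
have : ut_mk 0 1 0 0 0 0 \in H.
  apply: fixH => h /HZ[h1 h2 h3].
  by apply: ut_ext; rewrite conjgE !utE !ut_mkE ?h1 ?h2 ?h3; ring.
by move=> /HZ[_]; rewrite ut_mkE.
Qed.

(** Modulo $[G,G]$ all of [H] is proportional to one [h0], so a second-central [x] commuting with
    [h0] commutes with [H] and belongs to it. *)
Lemma ut_rk1_1 r2 : has_rk1 H 1 -> has_rk2 H r2 -> (0 < r2)%N.
Proof.
move=> r1 [_ max2]; have [[a /indep1P[aH ai]] _] := r1.
pose h0 := a ord0.
(* The coordinates of [x] solve [ell x h0 = 0]; when this equation is trivial, any noncentral choice
   works. *)
pose x := if (c12 h0 == 0) && (c34 h0 == 0) then ut_mk 0 0 0 1 0 0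
          else ut_mk 0 0 0 (c12 h0) (c34 h0) 0.
have xZ : in_Z2 x by rewrite /x; case: ifP; rewrite /in_Z2 !ut_mkE.
have x0 : ell x h0 = 0.
  rewrite /x /ell; case: ifP => [/andP[/eqP-> /eqP->]|_]; rewrite !ut_mkE; ring.
have xc : ~ (c13 x = 0 /\ c24 x = 0).
  rewrite /x; case: ifPn; rewrite !ut_mkE; first by move=> _ [].
  by move=> /negP n [e1 e2]; apply: n; rewrite e1 e2.
have xH : x \in H.
  apply: perpH => // h hH; pose b (i : 'I_2) := if i == ord0 then h0 else h.
  have bH i : b i \in H by rewrite /b; case: ifP => _ //; exact: aH.
  have [m [[i mi] mP]] := dep1 r1 bH isT.
  have mE j : m ord0 * co1 h0 j + m (lift ord0 ord0) * co1 h j = 0.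
    by have := mP j; rewrite !big_ord_recl big_ord0 addr0.
  have m1 : m (lift ord0 ord0) != 0.
    apply: contraNneq mi => m1; apply/eqP.
    have m0 : m ord0 = 0.
      apply: (ai (fun=> m ord0) _ ord0) => j; rewrite big_ord1.
      by have := mE j; rewrite m1 mul0r addr0.
    have [j ->|->//] := unliftP ord0 i; by rewrite (ord1 j).
  have := mE (inord 0); have := mE (inord 2); rewrite /co1 !inordK //= => e3 e1.
  apply: (mulfI m1); rewrite mulr0.
  have -> : m (lift ord0 ord0) * ell x h = - (m ord0 * ell x h0) +
    (c13 x * (m ord0 * c34 h0 + m (lift ord0 ord0) * c34 h)
     - (m ord0 * c12 h0 + m (lift ord0 ord0) * c12 h) * c24 x) by rewrite /ell; ring.
  by rewrite e1 e3 x0; ring.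
apply: (max2 1%N (fun=> x)); apply/indep2P; split=> // m mP i.
rewrite (ord1 i); apply/eqP/negPn/negP => mi; apply: xc; apply/co2_eq0 => j.
by have := mP j; rewrite big_ord1 => /eqP; rewrite mulf_eq0 (negPf mi) => /eqP.
Qed.

(** [H] contains elements equal modulo $[G,G]$ to nonzero multiples of the three basis vectors; the
    commutators of the consecutive ones are independent modulo the centre. *)
Lemma ut_rk1_3 r2 : has_rk1 H 3 -> has_rk2 H r2 -> (1 < r2)%N.
Proof.
move=> r1 [_ max2]; have [[a /indep1P[aH ai]] _] := r1.
have mult (v : UT4) : exists h (N : int),
    [/\ h \in H, N != 0 & forall j, co1 h j = N * co1 v j].
  pose b (i : 'I_4) := if unlift ord0 i is Some k then a k else v.
  have [m [[i mi] mP]] : exists m : 'I_4 -> int, (exists i, m i != 0) /\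
      forall j, \sum_i m i * co1 (b i) j = 0.
    by apply: not_zindep => /zindep_le.
  have mE j : m ord0 * co1 v j + \sum_k m (lift ord0 k) * co1 (a k) j = 0.
    have := mP j; rewrite big_ord_recl /b unlift_none.
    by under eq_bigr do rewrite liftK.
  exists (\prod_k expgz (a k) (m (lift ord0 k)))%g, (- m ord0); split.
  - apply: gpred_prod => k _.
    by case: (m _) => l; rewrite /expgz ?gpredV gpredXn.
  - rewrite oppr_eq0; apply: contraNneq mi => m0; apply/eqP.
    have [k ->|->//] := unliftP ord0 i.
    apply: (ai (fun k => m (lift ord0 k))) => j.
    by have := mE j; rewrite m0 mul0r add0r.
  - move=> j; rewrite co1_prod mulNr; apply/eqP; rewrite -addr_eq0 addrC.
    by apply/eqP/mE.
have [h1 [N1 [h1H N1n e1]]] := mult (ut_mk 1 0 0 0 0 0).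
have [h2 [N2 [h2H N2n e2]]] := mult (ut_mk 0 1 0 0 0 0).
have [h3 [N3 [h3H N3n e3]]] := mult (ut_mk 0 0 1 0 0 0).
have := (e1 (inord 0), e1 (inord 1), e1 (inord 2)).
have := (e2 (inord 0), e2 (inord 1), e2 (inord 2)).
have := (e3 (inord 0), e3 (inord 1), e3 (inord 2)).
rewrite /co1 !inordK //= !ut_mkE !mulr0 !mulr1.
move=> [[p1 p2] p3] [[q1 q2] q3] [[s1 s2] s3].
pose b (i : 'I_2) := if i == ord0 then [~ h1, h2]%g else [~ h2, h3]%g.
apply: (max2 2%N b); apply/indep2P; split=> [i|m mP i].
  rewrite /b; case: ifP => _; split; rewrite ?gpredR // /in_Z2 commgEl conjgE !utE.
    by split; ring.
  by split; ring.
have := mP (inord 0); have := mP (inord 1); rewrite !big_ord_recl !big_ord0 /co2 !inordK //=.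
rewrite /b /= !commgEl !conjgE !utE p1 p2 p3 q1 q2 q3 s1 s2 s3 => t2 t1.
have m0 : m ord0 = 0.
  have /eqP : m ord0 * (N1 * N2) = 0 by rewrite -[RHS]t1; ring.
  by rewrite !mulf_eq0 (negPf N1n) (negPf N2n) !orbF => /eqP.
have m1 : m (lift ord0 ord0) = 0.
  have /eqP : m (lift ord0 ord0) * (N2 * N3) = 0 by rewrite -[RHS]t2; ring.
  by rewrite !mulf_eq0 (negPf N3n) (negPf N2n) !orbF => /eqP.
have [j ->|->//] := unliftP ord0 i; by rewrite (ord1 j).
Qed.

(** The three preceding lemmas exclude the pairs with $r_1 = 0$ and (1,0), (3,0), (3,1). *)
Lemma ut_ranks : exists r1 r2, [/\ has_rk1 H r1, has_rk2 H r2 &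
  (r1, r2) \in [:: (1, 1); (2, 0); (2, 1); (1, 2); (2, 2); (3, 2)]%N].
Proof.
have [r1 le1 rk1] := ut_rk1_ex H; have [r2 le2 rk2] := ut_rk2_ex H.
exists r1, r2; split=> //.
move: r1 r2 le1 le2 rk1 rk2 => [|[|[|[|r1]]]] [|[|[|r2]]] // _ _ h1 h2.
all: try by case: (ut_rk1_neq0 h1).
all: try by have := ut_rk1_1 h1 h2.
all: by have := ut_rk1_3 h1 h2.
Qed.

End Ranks.

(** * The correspondence with isomorphism classes *)

Lemma conj_pair_iso (K : fieldType) g (y1 y2 : irr_pair UT4 K) :
  conj_pair g y1 y2 -> rep_iso (ip_ind y1) (ip_ind y2).
Proof.
move=> [HE cE]; apply: rep_iso_sym.
have w : wt (ip_char y2) (rep_act g (delta (ip_char y1))).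
  move=> h hH; have hg : (h ^ g)%g \in ip_sub y1 by rewrite -conj_setE -HE.
  rewrite rep_act_swap delta_wt // rep_actZ; congr (_ *: _).
  have [u hu] := subg_val hH; have [z hz] := subg_val hg.
  by rewrite hz hu !char_ext_val; apply/esym/cE; rewrite -hz -hu.
have [phi tw e] := frobenius w; exists phi => //.
apply: (irr_intertwiner_bij (v := delta _) (ip_irr y2) (ip_irr y1) tw).
by rewrite e rep_act_eq0 delta_neq0.
Qed.

(** Makes the map from [X_space] to isomorphism classes both well defined and injective. *)
Lemma X_rel_iso (K : fieldType) (y1 y2 : irr_pair UT4 K) :
  X_rel y1 y2 <-> rep_iso (ip_ind y1) (ip_ind y2).
Proof.
split=> [/asboolP|]; last exact: iso_X_rel.
elim=> {y1 y2} [y1 y2 [//|//|g]|y|y1 y2 _|y1 y2 y3 _ h12 _ h23].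
- exact: conj_pair_iso.
- exact: rep_iso_refl.
- exact: rep_iso_sym.
- exact: rep_iso_trans h12 h23.
Qed.

Lemma iso_classP (G : groupType) (K : fieldType) (V W : representation G K) :
  iso_class V = iso_class W <-> rep_iso V W.
Proof.
split=> [e|iso]; first by rewrite -/(iso_class V W) e; exact: rep_iso_refl.
apply/funext => U; apply/propext; split; apply: rep_iso_trans => //.
exact: rep_iso_sym.
Qed.

(** Witnesses that the group is countable; numbers coding no unitriangular matrix decode to 1. *)
Definition ut_code (g : UT4) : nat := pickle (val g).
Definition ut_decode (n : nat) : UT4 :=
  if unpickle n is Some A then insubd (1%g : UT4) A else 1%g.

Lemma ut_codeK : cancel ut_code ut_decode.
Proof. by move=> g; rewrite /ut_decode /ut_code pickleK valKd. Qed.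

Local Open Scope quotient_scope.

Theorem theorem1 (R : realType) :
  exists F : X_space UT4 R[i] -> representation UT4 R[i] -> Prop,
    (forall y : irr_pair UT4 R[i],
       F (\pi_(X_space UT4 R[i]) y) = iso_class (ip_ind y)) /\
    bij_between
      (@X_union UT4 R[i]
         [:: (1, 1); (2, 0); (2, 1); (1, 2); (2, 2); (3, 2)]%N)
      (@moduli UT4 R[i])
      (fun rx => F rx.2).
Proof.
have X_eq (y1 y2 : irr_pair UT4 R[i]) :
    \pi_(X_space UT4 R[i]) y1 = \pi y2 <-> rep_iso (ip_ind y1) (ip_ind y2).
  by rewrite -X_rel_iso; split=> /eqmodP.
exists (fun x => iso_class (ip_ind (repr x))); split=> [y|].
  by apply/iso_classP/X_eq; rewrite reprK.
split.
- move=> [r x] _; exists (ip_ind (repr x)); split=> //; first exact: ip_irr.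
  exact: (ind_finite_weight (@complex_uncountable R) ut_codeK (ip_irr _)).
(* A point of [X_space] determines its class in [Xi_space], hence its ranks by [Xi_rank]: no point
   occurs under two indices. *)
- move=> [r x] [s x'] /= [_ [H1 [h11 h12] e1]] [_ [H2 [h21 h22] e2]].
  move=> /iso_classP/X_eq; rewrite !reprK => xx'; rewrite -xx' /= in e2 *.
  congr (_, _); have /eqmodP H12 : \pi_(Xi_space UT4 R[i]) H1 = \pi H2.
    by rewrite e1 e2.
  have := Xi_rank H12 h11 h12 h21 h22.
  by rewrite -!surjective_pairing.
- move=> c [V [-> irrV fwV]].
  have [H [chi [irr iso]]] := ut_monomial irrV fwV.
  pose y := IrrPair irr.
  have [r1 [r2 [h1 h2 r12]]] :=
    ut_ranks (ind_normalizer (@complex_uncountable R) ut_codeK irr).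
  exists ((r1, r2), \pi_(X_space UT4 R[i]) y) => /=.
    split=> //=; exists (ip_ws y) => //=.
    by rewrite X_to_XiE.
  apply/iso_classP; apply: rep_iso_trans iso.
  by apply/(X_eq _ y); rewrite reprK.
Qed.
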